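(* For $j=1,\dots,l$, regard the idempotent $F_{\mathfrak t^{\lambda_2^j}}$ as an element of $H_n$. Then in $R_n$ $$f^{-1}\bigl(F_{\mathfrak t^{\lambda_2^j}}\bigr)=\sum_{\substack{\boldsymbol i\in I_e^n\\ i_1=\kappa_j,\ i_2=\kappa_j+1}}e(\boldsymbol i).$$ In particular $B_n'=B_n$; that is, under the isomorphism $f:R_n\to H_n$ the generalized blob algebra $B_n'=H_n/\mathcal I_n$ of Martin and Woodcock coincides with the quotient $B_n$ of $R_n$.
   Context: **KLR and blob algebras.** Fix integers $e,l,n>1$, a field $F$ and a primitive $e$-th root of unity $q\in F\setminus\{1\}$; $I_e=\mathbb Z/e\mathbb Z$; $S_n$ acts on $I_e^n$ by permuting coordinates, $s_r=(r,r+1)$. Fix $\hat\kappa\in\mathbb Z^l$; $\kappa_m\in I_e$ is the image of $\hat\kappa_m$, also identified with its representative in $\{0,\dots,e-1\}$. $\hat\kappa$ is strongly adjacency-free: (i) $\hat\kappa_{m+1}-\hat\kappa_m\ge n$; (ii) $\kappa_i-\kappa_j\not\equiv 0,\pm1\bmod e$ for $i\ne j$; (iii) $\kappa_1\not\equiv\kappa_l+2\bmod e$; (iv) $\kappa_1<\dots<\kappa_l$. The generalized blob algebra $B_n$ is the unital associative $F$-algebra with generators $\psi_1,\dots,\psi_{n-1},y_1,\dots,y_n,e(\boldsymbol i)$ ($\boldsymbol i\in I_e^n$) and relations: $e(\boldsymbol i)e(\boldsymbol j)=\delta_{\boldsymbol i\boldsymbol j}e(\boldsymbol i)$; $\sum_{\boldsymbol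 i}e(\boldsymbol i)=1$; $e(\boldsymbol i)=0$ if $i_1\notin\{\kappa_1,\dots,\kappa_l\}$; (†) $e(\boldsymbol i)=0$ if $i_1\in\{\kappa_1,\dots,\kappa_l\}$ and $i_2=i_1+1$; $y_1e(\boldsymbol i)=0$ if $i_1\in\{\kappa_1,\dots,\kappa_l\}$; $y_re(\boldsymbol i)=e(\boldsymbol i)y_r$; $\psi_re(\boldsymbol i)=e(s_r\cdot\boldsymbol i)\psi_r$; $y_ry_s=y_sy_r$; $\psi_ry_s=y_s\psi_r$ if $s\ne r,r+1$; $\psi_r\psi_s=\psi_s\psi_r$ if $|r-s|>1$; $\psi_ry_{r+1}e(\boldsymbol i)=(y_r\psi_r-\delta_{i_r,i_{r+1}})e(\boldsymbol i)$; $y_{r+1}\psi_re(\boldsymbol i)=(\psi_ry_r-\delta_{i_r,i_{r+1}})e(\boldsymbol i)$; $\psi_r^2e(\boldsymbol i)$ equals $0$ if $i_r=i_{r+1}$, $e(\boldsymbol i)$ if $i_r\ne i_{r+1},i_{r+1}\pm1$, $(y_{r+1}-y_r)e(\boldsymbol i)$ if $i_{r+1}=i_r+1$, $(y_r-y_{r+1})e(\boldsymbol i)$ if $i_{r+1}=i_r-1$; $\psi_r\psi_{r+1}\psi_re(\boldsymbol i)=(\psi_{r+1}\psi_r\psi_{r+1}+\alpha)e(\boldsymbol i)$ with $\alpha=-1$ if $i_{r+2}=i_r=i_{r+1}-1$, $\alpha=1$ if $i_{r+2}=i_r=i_{r+1}+1$, $\alpha=0$ otherwise. The cyclotomic KLR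 algebra $R_n$ has the same presentation with (†) omitted. **Hecke algebra.** $H_n=H_n(q,\kappa)$ is the $F$-algebra with generators $L_1,\dots,L_n,T_1,\dots,T_{n-1}$ and relations $(L_1-q^{\kappa_1})\cdots(L_1-q^{\kappa_l})=0$, $(T_r+1)(T_r-q)=0$, $T_sT_{s+1}T_s=T_{s+1}T_sT_{s+1}$, $L_rL_s=L_sL_r$, $T_rL_r=L_{r+1}(T_r-q+1)$, $T_rL_s=L_sT_r$ if $s\ne r,r+1$, $T_rT_s=T_sT_r$ if $|r-s|>1$. $H_2\subseteq H_n$ is the subalgebra generated by $L_1,L_2,T_1$. The $F$-algebra isomorphism $f:R_n\to H_n$ is that of Brundan-Kleshchev and Rouquier: $f(e(\boldsymbol i))$ is the idempotent projecting onto the simultaneous generalized eigenspace of $L_1,\dots,L_n$ with eigenvalues $q^{i_1},\dots,q^{i_n}$ (it is $0$ if this eigenspace is $0$), and $f(y_k)f(e(\boldsymbol i))=(1-q^{-i_k}L_k)f(e(\boldsymbol i))$. **Idempotents.** Let $\hat q$ be a variable, $K=F(\hat q)$, and $O=\{a(\hat q)/b(\hat q)\in K: b(q)\ne0\}$, a local ring with residue field $F$ via $\hat q\mapsto q$. $H_2^{K}$ and $H_2^{O}$ are the algebras over $K$, resp. $O$, with the same presentation as $H_2$, but with $q$ replaced by $\hat q$ and $q^{\kappa_m}$ by $\hat q^{\hat\kappa_m}$; $H_2^O\otimes_O F\cong H_2$, $H_2^O\otimes_OK\cong H_2^K$. Let $\mathrm{Std}(2)$ be the set of standard tableaux of all $l$-multipartitions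 of $2$ (bijections from $\{1,2\}$ to the diagram, with entries increasing along rows and down columns in every component). For $\mathfrak s\in\mathrm{Std}(2)$ with $\mathfrak s(k)=(r,c,m)$ (row $r$, column $c$, component $m$) put $c^K_{\mathfrak s}(k)=\hat q^{\hat\kappa_m+c-r}$, and $$F_{\mathfrak s}=\prod_{k=1}^2\ \prod_{\substack{\mathfrak t\in\mathrm{Std}(2)\\ c^K_{\mathfrak t}(k)\ne c^K_{\mathfrak s}(k)}}\frac{L_k-c^K_{\mathfrak t}(k)}{c^K_{\mathfrak s}(k)-c^K_{\mathfrak t}(k)}\in H_2^K .$$ For $1\le j\le l$, $\lambda_2^j=(\emptyset,\dots,(2),\dots,\emptyset)$ is the $l$-multipartition of $2$ with $(2)$ in position $j$ and $\mathfrak t^{\lambda_2^j}$ is its unique standard tableau. One has $F_{\mathfrak t^{\lambda_2^j}}\in H_2^O$, and viewing it as an element of $H_n$ means taking its image in $H_2^O\otimes_OF=H_2\subseteq H_n$. The algebra $H_2$ is semisimple; $e_2^j\in H_2$ denotes the primitive central idempotent of the one-dimensional module labelled by $\lambda_2^j$ (on which $L_1=q^{\kappa_j}$, $L_2=q^{\kappa_j+1}$, $T_1=q$); the image of $F_{\mathfrak t^{\lambda_2^j}}$ in $H_2$ is $e_2^j$. $\mathcal I_n$ is the two-sided ideal of $H_n$ generated by $e_2^1,\dots,e_2^l$, and $B_n':=H_n/\mathcal I_n$ is the original generalized blob algebra of Martin-Woodcock. *)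

(* Defs.v *)
From HB Require Import structures.
From mathcomp Require Import all_boot all_order all_algebra.
From mathcomp Require Import generic_quotient ring_quotient fraction perm boolp.
From mathcomp Require Import finmap monalg.

Set Implicit Arguments.
Unset Strict Implicit.
Unset Printing Implicit Defensive.

Import GRing.Theory.
Local Open Scope ring_scope.
Local Open Scope quotient_scope.

(* Unital associative algebras over a commutative ring, as rings with a
   central structure map; algType is not used since it excludes the zero
   algebra, which a presentation or a quotient may produce. *)
HB.mixin Record PzRing_isAlgebra (R : comNzRingType) A of GRing.PzRing A := {
  scal : {rmorphism R -> A};
  scalC : forall (a : R) (x : A), scal a * x = x * scal a
}.

#[short(type="pzAlgType")]
HB.structure Definition PzAlgebra (R : comNzRingType) :=
  {A of GRing.PzRing A & PzRing_isAlgebra R A}.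

Notation "a %:S" := (scal a) (at level 1, format "a %:S") : ring_scope.

Definition scalar_morphism (R : comNzRingType) (A B : pzAlgType R)
  (f : A -> B) : Prop := forall a : R, f a%:S = a%:S.

Section Ideal.
Variables (R : comNzRingType) (A : pzAlgType R) (S : A -> Prop).

Inductive in_ideal : A -> Prop :=
| in_ideal_gen x : S x -> in_ideal x
| in_ideal0 : in_ideal 0
| in_idealB x y : in_ideal x -> in_ideal y -> in_ideal (x - y)
| in_idealM a x b : in_ideal x -> in_ideal (a * x * b).

Definition ideal_pred : {pred A} := fun x => `[< in_ideal x >].

Lemma ideal_zmod_closed : zmod_closed ideal_pred.
Proof.
split; first exact/asboolP/in_ideal0.
by move=> x y /asboolP Ix /asboolP Iy; apply/asboolP; exact: in_idealB.
Qed.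

HB.instance Definition _ := GRing.isZmodClosed.Build A ideal_pred
  ideal_zmod_closed.

Definition quot_alg := Quotient.quot ideal_pred.
HB.instance Definition _ := EqQuotient.on quot_alg.
HB.instance Definition _ := GRing.Zmodule.on quot_alg.

Definition qpi (x : A) : quot_alg := \pi_quot_alg x.

Lemma qpi_eq x y : qpi x = qpi y <-> in_ideal (x - y).
Proof.
have e : (qpi x == qpi y) = (x - y \in ideal_pred).
  exact/esym/(Quotient.idealrBE ideal_pred).
split=> [/eqP|h]; first by rewrite e => /asboolP.
by apply/eqP; rewrite e; apply/asboolP.
Qed.

Lemma qpi_repr u : qpi (repr u) = u.
Proof. by rewrite /qpi reprK. Qed.

Lemma qpiB : {morph qpi : x y / x - y}.
Proof. exact: (raddfB (\pi_quot_alg)). Qed.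

Lemma qpiD : {morph qpi : x y / x + y}.
Proof. exact: (raddfD (\pi_quot_alg)). Qed.

Definition qone : quot_alg := qpi 1.
Definition qmul (u v : quot_alg) : quot_alg := qpi (repr u * repr v).

Lemma qpi_mul x y : qmul (qpi x) (qpi y) = qpi (x * y).
Proof.
apply/qpi_eq; set x' := repr _; set y' := repr _.
have hx : in_ideal (x' - x) by apply/qpi_eq; rewrite qpi_repr.
have hy : in_ideal (y' - y) by apply/qpi_eq; rewrite qpi_repr.
have -> : x' * y' - x * y = 1 * (x' - x) * y' - (- x) * (y' - y) * 1.
  by rewrite mul1r mulr1 mulNr opprK mulrBl mulrBr subrKA.
by apply: in_idealB; apply: in_idealM.
Qed.

Let elim (P : quot_alg -> Prop) : (forall x, P (qpi x)) -> forall u, P u.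
Proof. by move=> h u; rewrite -[u]qpi_repr. Qed.

Lemma qmulA : associative qmul.
Proof.
by elim/elim=> x; elim/elim=> y; elim/elim=> z; rewrite !qpi_mul mulrA.
Qed.

Lemma qmul1r : left_id qone qmul.
Proof. by elim/elim=> x; rewrite qpi_mul mul1r. Qed.

Lemma qmulr1 : right_id qone qmul.
Proof. by elim/elim=> x; rewrite qpi_mul mulr1. Qed.

Lemma qmulDl : left_distributive qmul +%R.
Proof.
elim/elim=> x; elim/elim=> y; elim/elim=> z.
by rewrite -qpiD !qpi_mul -qpiD mulrDl.
Qed.

Lemma qmulDr : right_distributive qmul +%R.
Proof.
elim/elim=> x; elim/elim=> y; elim/elim=> z.
by rewrite -qpiD !qpi_mul -qpiD mulrDr.
Qed.

HB.instance Definition _ := GRing.Zmodule_isPzRing.Build quot_alg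
  qmulA qmul1r qmulr1 qmulDl qmulDr.

Lemma qpi_monoid_morphism : monoid_morphism qpi.
Proof. by split=> // x y; rewrite -qpi_mul. Qed.

HB.instance Definition _ := GRing.isZmodMorphism.Build A quot_alg qpi qpiB.
HB.instance Definition _ := GRing.isMonoidMorphism.Build A quot_alg qpi
  qpi_monoid_morphism.

Definition qscal (a : R) : quot_alg := qpi a%:S.

HB.instance Definition _ :=
  GRing.RMorphism.copy qscal (qpi \o (scal : R -> A)).

Lemma qscalC a (u : quot_alg) : qscal a * u = u * qscal a.
Proof. by elim/elim: u => x; have := congr1 qpi (scalC a x); rewrite !rmorphM. Qed.

HB.instance Definition _ := PzRing_isAlgebra.Build R quot_alg qscalC.

End Ideal.

Section Subalgebra.
Variables (R : comNzRingType) (A : pzAlgType R) (X : Type) (phi : X -> A).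

Inductive in_subalg : A -> Prop :=
| in_subalg_gen x : in_subalg (phi x)
| in_subalgS a : in_subalg a%:S
| in_subalgD x y : in_subalg x -> in_subalg y -> in_subalg (x + y)
| in_subalgM x y : in_subalg x -> in_subalg y -> in_subalg (x * y).

Definition subalg_pred : {pred A} := fun x => `[< in_subalg x >].

Lemma subalg_subring_closed : subring_closed subalg_pred.
Proof.
have hM x y : in_subalg x -> in_subalg y -> in_subalg (x * y).
  exact: in_subalgM.
split; first by apply/asboolP; rewrite -(rmorph1 (scal : R -> A)); constructor.
  move=> x y /asboolP hx /asboolP hy; apply/asboolP/in_subalgD => //.
  rewrite -mulN1r; apply: hM => //.
  rewrite -(rmorph1 (scal : R -> A)) -rmorphN; exact: in_subalgS.
by move=> x y /asboolP hx /asboolP hy; apply/asboolP; exact: hM.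
Qed.

Definition subalg := {x : A | x \in subalg_pred}.
HB.instance Definition _ := SubChoice.on subalg.
HB.instance Definition _ :=
  GRing.SubChoice_isSubPzRing.Build A subalg_pred subalg subalg_subring_closed.

Lemma scal_in_subalg a : a%:S \in subalg_pred.
Proof. exact/asboolP/in_subalgS. Qed.

Definition sub_scal (a : R) : subalg := Sub a%:S (scal_in_subalg a).

Lemma sub_scal_zmod_morphism : zmod_morphism sub_scal.
Proof. by move=> a b; apply: val_inj; rewrite /= rmorphB. Qed.

Lemma sub_scal_monoid_morphism : monoid_morphism sub_scal.
Proof.
by split=> [|a b]; apply: val_inj; rewrite /= ?rmorph1 ?rmorphM.
Qed.

HB.instance Definition _ := GRing.isZmodMorphism.Build R subalg sub_scal
  sub_scal_zmod_morphism.
HB.instance Definition _ := GRing.isMonoidMorphism.Build R subalg sub_scal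
  sub_scal_monoid_morphism.

Lemma sub_scalC a (x : subalg) : sub_scal a * x = x * sub_scal a.
Proof. by apply: val_inj; rewrite !rmorphM /= scalC. Qed.

HB.instance Definition _ := PzRing_isAlgebra.Build R subalg sub_scalC.

Lemma gen_in_subalg x : phi x \in subalg_pred.
Proof. exact/asboolP/in_subalg_gen. Qed.

Definition sub_gen (x : X) : subalg := Sub (phi x) (gen_in_subalg x).

End Subalgebra.

(* The free R-algebra on X: the library's monoid algebra of the free monoid,
   with a locked product to keep conversion tractable. *)
Section Free.
Variables (R : comNzRingType) (X : choiceType).

Definition free_alg : Type := {malg R[{fmonom X}]}.
HB.instance Definition _ := GRing.Zmodule.on free_alg.

Fact free_key : unit. Proof. exact: tt. Qed.

Definition free_mul : free_alg -> free_alg -> free_alg :=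
  locked_with free_key (@fgmul {fmonom X} R).
Definition free_one : free_alg := locked_with free_key (@fgone {fmonom X} R).
Definition free_scal (a : R) : free_alg :=
  locked_with free_key (a%:MP : {malg R[{fmonom X}]}).
Definition fgen (x : X) : free_alg :=
  locked_with free_key (<< fmu x >> : {malg R[{fmonom X}]}).

Lemma free_mulE p q : free_mul p q = fgmul p q.
Proof. by rewrite /free_mul unlock. Qed.
Lemma free_oneE : free_one = fgone _ _. Proof. exact: unlock. Qed.
Lemma free_scalE a : free_scal a = (a%:MP : {malg R[{fmonom X}]}).
Proof. exact: unlock. Qed.
Lemma fgenE x : fgen x = (<< fmu x >> : {malg R[{fmonom X}]}).
Proof. exact: unlock. Qed.

Lemma free_mulA : associative free_mul.
Proof. by move=> p q r; rewrite !free_mulE fgmulA. Qed.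
Lemma free_mul1 : left_id free_one free_mul.
Proof. by move=> p; rewrite free_mulE free_oneE fgmul1g. Qed.
Lemma free_mulr1 : right_id free_one free_mul.
Proof. by move=> p; rewrite free_mulE free_oneE fgmulg1. Qed.
Lemma free_mulDl : left_distributive free_mul +%R.
Proof. by move=> p q r; rewrite !free_mulE; exact: fgmulgDl. Qed.
Lemma free_mulDr : right_distributive free_mul +%R.
Proof. by move=> p q r; rewrite !free_mulE; exact: fgmulgDr. Qed.

HB.instance Definition _ := GRing.Zmodule_isPzRing.Build free_alg
  free_mulA free_mul1 free_mulr1 free_mulDl free_mulDr.

Lemma free_scal_zmod_morphism : zmod_morphism free_scal.
Proof. by move=> a b; rewrite !free_scalE; exact: monalgUB. Qed.

Lemma free_scal_monoid_morphism : monoid_morphism free_scal.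
Proof.
split; first by rewrite free_scalE; exact/esym/free_oneE.
move=> a b; rewrite [RHS]free_mulE !free_scalE; exact: (@mpolyCM {fmonom X}).
Qed.

HB.instance Definition _ := GRing.isZmodMorphism.Build R free_alg free_scal
  free_scal_zmod_morphism.
HB.instance Definition _ := GRing.isMonoidMorphism.Build R free_alg free_scal
  free_scal_monoid_morphism.

Lemma free_scalC a (p : free_alg) : free_scal a * p = p * free_scal a.
Proof.
rewrite [LHS]free_mulE [RHS]free_mulE free_scalE fgmulUg fgmulgU.
by apply: eq_bigr => k _; rewrite mul1m mulm1 mulrC.
Qed.

HB.instance Definition _ := PzRing_isAlgebra.Build R free_alg free_scalC.

End Free.

Section FreeEval.
Variables (R S : comNzRingType) (sigma : {rmorphism R -> S}).
Variables (X : choiceType) (A : pzAlgType S) (phi : X -> A).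

Definition monom_eval (m : {fmonom X}) : A := \prod_(x <- (m : seq X)) phi x.

Definition free_sum (p : {malg R[{fmonom X}]}) : A :=
  \sum_(m <- msupp p) (sigma p@_m)%:S * monom_eval m.

(* The homomorphism from the free R-algebra on X to the S-algebra A which is
   semilinear along sigma and sends the generator x to phi x. *)
Definition free_eval : free_alg R X -> A := locked_with free_key free_sum.

Lemma free_evalEsum p : free_eval p = free_sum p.
Proof. by rewrite /free_eval unlock. Qed.

Lemma free_sumEw (d : {fset {fmonom X}}) p : (msupp p `<=` d)%fset ->
  free_sum p = \sum_(m <- d) (sigma p@_m)%:S * monom_eval m.
Proof.
move=> le; rewrite /free_sum (big_fset_incl _ le) // => x xd /mcoeff_outdom ->.
by rewrite !rmorph0 mul0r.
Qed.

Lemma free_sumU c m : free_sum << c *g m >> = (sigma c)%:S * monom_eval m.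
Proof. by rewrite (free_sumEw msuppU_le) big_seq_fset1 mcoeffUU. Qed.

Lemma free_sum_zmod_morphism : zmod_morphism free_sum.
Proof.
move=> p q; have hD : (msupp p `<=` msupp p `|` msupp q)%fset.
  exact: fsubsetUl.
rewrite (free_sumEw (msuppB_le p q)) (free_sumEw hD).
rewrite (free_sumEw (fsubsetUr (msupp p) _)) -sumrB; apply: eq_bigr => k _.
by rewrite mcoeffB !rmorphB mulrBl.
Qed.

HB.instance Definition _ := GRing.isZmodMorphism.Build {malg R[{fmonom X}]} A
  free_sum free_sum_zmod_morphism.

Lemma free_eval_zmod_morphism : zmod_morphism free_eval.
Proof. by move=> p q; rewrite !free_evalEsum; exact: raddfB. Qed.

HB.instance Definition _ := GRing.isZmodMorphism.Build (free_alg R X) A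
  free_eval free_eval_zmod_morphism.

Lemma free_eval_monoid_morphism : monoid_morphism free_eval.
Proof.
split.
  rewrite free_evalEsum [X in free_sum X]free_oneE free_sumU.
  by rewrite !rmorph1 mul1r /monom_eval fm1 big_nil.
move=> p q; rewrite free_evalEsum [X in free_sum X]free_mulE.
rewrite raddf_sum !free_evalEsum mulr_suml /=; apply: eq_bigr => i _.
rewrite raddf_sum mulr_sumr /=; apply: eq_bigr => j _.
rewrite free_sumU !rmorphM /monom_eval fmM big_cat /=.
by rewrite -!mulrA; congr (_ * _); rewrite !mulrA scalC.
Qed.

HB.instance Definition _ := GRing.isMonoidMorphism.Build (free_alg R X) A
  free_eval free_eval_monoid_morphism.

Lemma free_eval0 : free_eval 0 = 0.
Proof. exact: rmorph0. Qed.

Lemma free_eval1 : free_eval 1 = 1.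
Proof. exact: rmorph1. Qed.

Lemma free_evalD p q : free_eval (p + q) = free_eval p + free_eval q.
Proof. exact: rmorphD. Qed.

Lemma free_evalN p : free_eval (- p) = - free_eval p.
Proof. exact: rmorphN. Qed.

Lemma free_evalM p q : free_eval (p * q) = free_eval p * free_eval q.
Proof. exact: rmorphM. Qed.

Lemma free_eval_gen x : free_eval (fgen R x) = phi x.
Proof.
rewrite free_evalEsum fgenE free_sumU !rmorph1 mul1r /monom_eval fmU.
exact: big_seq1.
Qed.

Lemma free_eval_scal a : free_eval a%:S = (sigma a)%:S.
Proof.
rewrite free_evalEsum [X in free_sum X]free_scalE free_sumU /monom_eval fm1.
by rewrite big_nil mulr1.
Qed.

Definition free_evalE := (free_evalM, free_evalD, free_evalN, free_eval_gen,
  free_eval_scal, free_eval0, free_eval1).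

End FreeEval.

Section Presented.
Variables (R : comNzRingType) (X : choiceType).
Variable rel : free_alg R X -> free_alg R X -> Prop.

(* The R-algebra with generators X and relations u = v whenever rel u v. *)
Definition presented : Type :=
  quot_alg (fun z => exists u v, rel u v /\ z = u - v).
HB.instance Definition _ := PzAlgebra.on presented.

Definition pgen (x : X) : presented := qpi _ (fgen R x).

Lemma free_eval_pgen (p : free_alg R X) :
  free_eval idfun pgen p = qpi _ p :> presented.
Proof.
rewrite free_evalEsum [p in RHS](monalgE p).
rewrite (raddf_sum (qpi _ : free_alg R X -> presented)).
apply: eq_bigr => m _ /=.
have -> : << p@_m *g m >> = (p@_m)%:S * (<< m >> : free_alg R X).
  by rewrite [RHS]free_mulE [_%:S]free_scalE fgmulUU mulr1 mul1m.
rewrite rmorphM; congr (_ * _); rewrite /monom_eval.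
case: m => s; elim: s => [|x s IHs] /=.
  rewrite big_nil -(rmorph1 (qpi _ : free_alg R X -> presented)).
  congr qpi; rewrite [LHS]free_oneE.
  by congr << _ *g _ >>; apply/val_inj; rewrite /= fm1.
rewrite big_cons IHs -rmorphM [_ * _]free_mulE fgenE fgmulUU mulr1.
by congr qpi; congr << _ *g _ >>; apply/val_inj; rewrite /= fmM fmU.
Qed.

Lemma pgen_rel u v : rel u v ->
  free_eval idfun pgen u = free_eval idfun pgen v.
Proof.
move=> uv; rewrite !free_eval_pgen; apply/qpi_eq/in_ideal_gen.
by exists u, v.
Qed.

Variables (S : comNzRingType) (sigma : {rmorphism R -> S}).
Variables (A : pzAlgType S) (phi : X -> A).

(* The homomorphism induced by pgen x |-> phi x, semilinear along sigma; it is
   meaningful when phi satisfies the relations, as in the lemmas below. *)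
Definition plift (u : presented) : A := free_eval sigma phi (repr u).

Hypothesis phi_rel : forall u v, rel u v ->
  free_eval sigma phi u = free_eval sigma phi v.

Lemma plift_qpi (p : free_alg R X) :
  plift (qpi _ p : presented) = free_eval sigma phi p.
Proof.
apply/eqP; rewrite -subr_eq0 /plift -rmorphB; apply/eqP.
set I := fun z => _; have : in_ideal I (repr (qpi I p) - p).
  by apply/qpi_eq; rewrite qpi_repr.
elim=> [_ [u [v [/phi_rel uv ->]]]||x y _ hx _ hy|a x b _ hx].
- by rewrite rmorphB /= uv subrr.
- exact: rmorph0.
- by rewrite rmorphB hx hy subrr.
- by rewrite !rmorphM hx mulr0 mul0r.
Qed.

Lemma plift_gen x : plift (pgen x) = phi x.
Proof. by rewrite plift_qpi free_eval_gen. Qed.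

Lemma plift_scal a : plift a%:S = (sigma a)%:S.
Proof. by rewrite (plift_qpi a%:S) free_eval_scal. Qed.

Lemma plift_zmod_morphism : zmod_morphism plift.
Proof.
move=> u v; rewrite -[u]qpi_repr -[v]qpi_repr -qpiB.
by rewrite !plift_qpi rmorphB.
Qed.

Lemma plift_monoid_morphism : monoid_morphism plift.
Proof.
split; first by rewrite (plift_qpi 1) rmorph1.
move=> u v; rewrite -[u]qpi_repr -[v]qpi_repr -[in LHS]rmorphM.
by rewrite !plift_qpi rmorphM.
Qed.

End Presented.

Definition lo (n : nat) (r : 'I_n.-1) : 'I_n := widen_ord (leq_pred n) r.

Lemma hi_subproof (n : nat) (r : 'I_n.-1) : (r.+1 < n)%N.
Proof. by case: n r => [|n] []. Qed.

(* Indices start at 0, so that psi r, T r stand for the generators acting on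
   the places lo r = r and hi r = r + 1. *)
Definition hi (n : nat) (r : 'I_n.-1) : 'I_n := Ordinal (hi_subproof r).

Definition residues (e n : nat) := {ffun 'I_n -> 'Z_e}.

Definition swap_res (e n : nat) (r : 'I_n.-1) (i : residues e n) :
  residues e n := [ffun k => i (tperm (lo r) (hi r) k)].

Inductive klr_index (e n : nat) :=
| Psi of 'I_n.-1
| Y of 'I_n
| E of residues e n.

Definition klr_index_code e n (g : klr_index e n) :
    'I_n.-1 + 'I_n + residues e n :=
  match g with Psi r => inl (inl r) | Y k => inl (inr k) | E i => inr i end.

Definition klr_index_decode e n (s : 'I_n.-1 + 'I_n + residues e n) :
    klr_index e n :=
  match s with
  | inl (inl r) => Psi e r | inl (inr k) => Y e k | inr i => E i
  end.

Lemma klr_index_codeK e n :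
  cancel (@klr_index_code e n) (@klr_index_decode e n).
Proof. by case. Qed.

HB.instance Definition _ e n :=
  Choice.copy (klr_index e n) (can_type (@klr_index_codeK e n)).

Section KLR.
Variables (F : fieldType) (e l n : nat) (kappa : 'I_l -> 'Z_e).

Implicit Types (i j : residues e n) (k m : 'I_n) (r s : 'I_n.-1).

Local Notation A := (free_alg F (klr_index e n)).
Local Notation psi r := (fgen F (Psi e r)).
Local Notation y k := (fgen F (Y e k)).
Local Notation ee i := (fgen F (E i)).

Definition braid_coef (i : residues e n) (a b c : 'I_n) : A :=
  if (i c == i a) && (i a == i b - 1) then -1
  else if (i c == i a) && (i a == i b + 1) then 1 else 0.

Inductive klr_rel : A -> A -> Prop :=
| klr_EE i j : klr_rel (ee i * ee j) (if i == j then ee i else 0)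
| klr_sumE : klr_rel (\sum_(i : residues e n) ee i) 1
| klr_E0 i k of k = 0%N :> nat & i k \notin codom kappa :
    klr_rel (ee i) 0
| klr_y1E i k of k = 0%N :> nat & i k \in codom kappa :
    klr_rel (y k * ee i) 0
| klr_yE k i : klr_rel (y k * ee i) (ee i * y k)
| klr_psiE r i : klr_rel (psi r * ee i) (ee (swap_res r i) * psi r)
| klr_yy k m : klr_rel (y k * y m) (y m * y k)
| klr_psiy r k of k != lo r & k != hi r :
    klr_rel (psi r * y k) (y k * psi r)
| klr_psipsi r s of (r.+1 < s)%N || (s.+1 < r)%N :
    klr_rel (psi r * psi s) (psi s * psi r)
| klr_psi_yhi r i :
    klr_rel (psi r * y (hi r) * ee i)
            ((y (lo r) * psi r - (i (lo r) == i (hi r))%:R) * ee i)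
| klr_yhi_psi r i :
    klr_rel (y (hi r) * psi r * ee i)
            ((psi r * y (lo r) - (i (lo r) == i (hi r))%:R) * ee i)
| klr_quad_eq r i of i (lo r) = i (hi r) :
    klr_rel (psi r ^+ 2 * ee i) 0
| klr_quad_far r i of i (lo r) != i (hi r) & i (lo r) != i (hi r) + 1 &
    i (lo r) != i (hi r) - 1 :
    klr_rel (psi r ^+ 2 * ee i) (ee i)
| klr_quad_up r i of i (hi r) = i (lo r) + 1 :
    klr_rel (psi r ^+ 2 * ee i) ((y (hi r) - y (lo r)) * ee i)
| klr_quad_down r i of i (hi r) = i (lo r) - 1 :
    klr_rel (psi r ^+ 2 * ee i) ((y (lo r) - y (hi r)) * ee i)
| klr_braid r s i of s = r.+1 :> nat :
    klr_rel (psi r * psi s * psi r * ee i)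
            ((psi s * psi r * psi s + braid_coef i (lo r) (hi r) (hi s))
             * ee i).

Inductive blob_rel : A -> A -> Prop :=
| blob_klr u v of klr_rel u v : blob_rel u v
| blob_E0 i k m of k = 0%N :> nat & m = 1%N :> nat &
    i k \in codom kappa & i m = i k + 1 : blob_rel (ee i) 0.

Definition klr_alg : Type := presented klr_rel.
HB.instance Definition _ := PzAlgebra.on klr_alg.

Definition blob_alg : Type := presented blob_rel.
HB.instance Definition _ := PzAlgebra.on blob_alg.

Definition klr_gen (g : klr_index e n) : klr_alg := pgen klr_rel g.
Definition blob_gen (g : klr_index e n) : blob_alg := pgen blob_rel g.

(* The canonical surjection R_n -> B_n. *)
Definition klr_to_blob : klr_alg -> blob_alg := plift idfun blob_gen.

Lemma klr_to_blob_rel u v : klr_rel u v ->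
  free_eval idfun blob_gen u = free_eval idfun blob_gen v.
Proof. by move=> uv; apply: pgen_rel; apply: blob_klr. Qed.

End KLR.

Inductive hecke_index (n : nat) := HL of 'I_n | HT of 'I_n.-1.

Definition hecke_index_code n (g : hecke_index n) : 'I_n + 'I_n.-1 :=
  match g with HL k => inl k | HT r => inr r end.

Definition hecke_index_decode n (s : 'I_n + 'I_n.-1) : hecke_index n :=
  match s with inl k => HL k | inr r => HT r end.

Lemma hecke_index_codeK n :
  cancel (@hecke_index_code n) (@hecke_index_decode n).
Proof. by case. Qed.

HB.instance Definition _ n :=
  Choice.copy (hecke_index n) (can_type (@hecke_index_codeK n)).

Section Hecke.
Variables (R : comNzRingType) (l n : nat) (q : R) (Q : 'I_l -> R).
Implicit Types (k m : 'I_n) (r s : 'I_n.-1).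

Local Notation A := (free_alg R (hecke_index n)).
Local Notation L k := (fgen R (HL k)).
Local Notation T r := (fgen R (HT r)).

Inductive hecke_rel : A -> A -> Prop :=
| hecke_cyc k of k = 0%N :> nat :
    hecke_rel (\prod_(j < l) (L k - (Q j)%:S)) 0
| hecke_quad r : hecke_rel ((T r + 1) * (T r - q%:S)) 0
| hecke_braid r s of s = r.+1 :> nat :
    hecke_rel (T r * T s * T r) (T s * T r * T s)
| hecke_LL k m : hecke_rel (L k * L m) (L m * L k)
| hecke_TLlo r :
    hecke_rel (T r * L (lo r)) (L (hi r) * (T r - q%:S + 1))
| hecke_TL r k of k != lo r & k != hi r :
    hecke_rel (T r * L k) (L k * T r)
| hecke_TT r s of (r.+1 < s)%N || (s.+1 < r)%N :
    hecke_rel (T r * T s) (T s * T r).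

Definition hecke_alg : Type := presented hecke_rel.
HB.instance Definition _ := PzAlgebra.on hecke_alg.

Definition hecke_gen (g : hecke_index n) : hecke_alg := pgen hecke_rel g.

End Hecke.

Section BaseChange.
Variables (R S : comNzRingType) (sigma : {rmorphism R -> S}).
Variables (l N : nat) (q : R) (Q : 'I_l -> R) (A : pzAlgType S).
Variable phi : hecke_index N -> A.

Lemma hecke_eval_rel (n : nat) (phi' : hecke_index n -> A)
    (Q' : 'I_l -> S) (iL : 'I_N -> 'I_n) (iT : 'I_N.-1 -> 'I_n.-1) :
  (forall u v, hecke_rel (sigma q) Q' u v ->
     free_eval idfun phi' u = free_eval idfun phi' v) ->
  (forall j, sigma (Q j) = Q' j) ->
  (forall k, iL k = k :> nat) -> (forall r, iT r = r :> nat) ->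
  (forall k, phi (HL k) = phi' (HL (iL k))) ->
  (forall r, phi (HT r) = phi' (HT (iT r))) ->
  forall u v, hecke_rel q Q u v ->
    free_eval sigma phi u = free_eval sigma phi v.
Proof.
move=> rel' QE iLE iTE pL pT u v.
have elo r : lo (iT r) = iL (lo r) by apply: val_inj; rewrite /= iTE iLE.
have ehi r : hi (iT r) = iL (hi r) by apply: val_inj; rewrite /= iTE iLE.
case=> [k k0|r|r s rs|k m|r|r k kl kh|r s rs].
- have := rel' _ _ (hecke_cyc (sigma q) Q' (k := iL k) _).
  rewrite iLE k0 => /(_ erefl); rewrite free_eval0 free_eval0 => E.
  rewrite -[RHS]E !rmorph_prod; apply: eq_bigr => j _ /=.
  by rewrite !free_evalD !free_evalN !free_eval_gen !free_eval_scal pL QE.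
- have := rel' _ _ (hecke_quad (sigma q) Q' (iT r)).
  by rewrite !free_evalE !pT.
- have := rel' _ _ (hecke_braid (sigma q) Q' (r := iT r) (s := iT s) _).
  by rewrite !iTE => /(_ rs); rewrite !free_evalM !free_eval_gen !pT.
- have := rel' _ _ (hecke_LL (sigma q) Q' (iL k) (iL m)).
  by rewrite !free_evalM !free_eval_gen !pL.
- have := rel' _ _ (hecke_TLlo (sigma q) Q' (iT r)).
  by rewrite !free_evalE !pT !pL elo ehi.
- have := rel' _ _ (hecke_TL (sigma q) Q' (r := iT r) (k := iL k) _ _).
  rewrite elo ehi -!val_eqE /= !iLE => /(_ kl kh).
  by rewrite !free_evalM !free_eval_gen !pT !pL.
- have := rel' _ _ (hecke_TT (sigma q) Q' (r := iT r) (s := iT s) _).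
  by rewrite !iTE => /(_ rs); rewrite !free_evalM !free_eval_gen !pT.
Qed.

End BaseChange.

(* O = {a / b : b(q) != 0} inside K = F(X), X playing the role of \hat q, and
   its residue map O -> F sending \hat q to q. *)
Section LocalRing.
Variables (F : fieldType) (q : F).

Local Notation K := {fraction {poly F}}.
Local Notation "p %:K" := (@tofrac {poly F} p) (at level 1, format "p %:K").

Definition loc_pred : {pred K} := fun x =>
  `[< exists ab : {poly F} * {poly F}, ab.2.[q] != 0 /\ x = ab.1%:K / ab.2%:K >].

Lemma loc_den_neq0 (b : {poly F}) : b.[q] != 0 -> b%:K != 0.
Proof. by rewrite tofrac_eq0; apply: contraNneq => ->; rewrite horner0. Qed.

Lemma loc_subring_closed : subring_closed loc_pred.
Proof.
split.
- by apply/asboolP; exists (1, 1); rewrite hornerC oner_neq0 divff ?tofrac_eq0 ?oner_eq0.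
- move=> _ _ /asboolP[[a b] [/= b0 ->]] /asboolP[[c d] [/= d0 ->]].
  apply/asboolP; exists (a * d - c * b, b * d); rewrite /= hornerM mulf_neq0 //.
  split=> //; rewrite tofracB !tofracM -mulNr addf_div ?loc_den_neq0 //.
  by rewrite mulNr.
- move=> _ _ /asboolP[[a b] [/= b0 ->]] /asboolP[[c d] [/= d0 ->]].
  apply/asboolP; exists (a * c, b * d); rewrite /= hornerM mulf_neq0 //.
  by rewrite !tofracM mulf_div.
Qed.

Definition loc_ring := {x : K | x \in loc_pred}.
HB.instance Definition _ := SubChoice.on loc_ring.
HB.instance Definition _ :=
  GRing.SubChoice_isSubComNzRing.Build K loc_pred loc_ring loc_subring_closed.

Definition loc_num_den (x : loc_ring) : {poly F} * {poly F} :=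
  sval (cid (asboolP _ (valP x))).

Definition loc_res (x : loc_ring) : F :=
  (loc_num_den x).1.[q] / (loc_num_den x).2.[q].

Lemma loc_resE (x : loc_ring) (a b : {poly F}) : b.[q] != 0 ->
  val x = a%:K / b%:K -> loc_res x = a.[q] / b.[q].
Proof.
move=> b0 xE; rewrite /loc_res /loc_num_den.
case: cid => -[c d] /= [d0]; rewrite xE => /eqP.
rewrite eqr_div ?loc_den_neq0 // -!tofracM tofrac_eq => /eqP ad.
by apply/eqP; rewrite eqr_div // -!hornerM ad.
Qed.

Lemma loc_repr (x : loc_ring) : exists a b : {poly F},
  [/\ b.[q] != 0, val x = a%:K / b%:K & loc_res x = a.[q] / b.[q]].
Proof.
case: (asboolP _ (valP x)) => -[a b] /= [b0 xE].
by exists a, b; split=> //; exact: loc_resE.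
Qed.

Lemma loc_res_zmod_morphism : zmod_morphism loc_res.
Proof.
move=> x y; have [a [b [b0 xE ->]]] := loc_repr x.
have [c [d [d0 yE ->]]] := loc_repr y.
rewrite (@loc_resE _ (a * d - c * b) (b * d)) ?hornerM ?mulf_neq0 //.
  by rewrite -[X in _ = _ + X]mulNr addf_div // mulNr hornerD hornerN !hornerM.
rewrite rmorphB /= xE yE tofracB !tofracM -mulNr.
by rewrite addf_div ?loc_den_neq0 // mulNr.
Qed.

Lemma loc_res_monoid_morphism : monoid_morphism loc_res.
Proof.
split.
  have h1 : (1 : {poly F}).[q] = 1 by exact: hornerC.
  have e1 : val (1 : loc_ring) = 1%:K / 1%:K by rewrite tofrac1 divr1.
  by rewrite (loc_resE _ e1) h1 ?oner_neq0 ?divr1.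
move=> x y; have [a [b [b0 xE ->]]] := loc_repr x.
have [c [d [d0 yE ->]]] := loc_repr y.
rewrite (@loc_resE _ (a * c) (b * d)) ?hornerM ?mulf_neq0 //.
  by rewrite mulf_div.
by rewrite rmorphM /= xE yE !tofracM mulf_div.
Qed.

HB.instance Definition _ := GRing.isZmodMorphism.Build loc_ring F loc_res
  loc_res_zmod_morphism.
HB.instance Definition _ := GRing.isMonoidMorphism.Build loc_ring F loc_res
  loc_res_monoid_morphism.

Definition qhat : K := 'X%:K.

(* The power of \hat q in O; q != 0 ensures that it lies there. *)
Definition loc_qhatX (z : int) : loc_ring := insubd 0 (qhat ^ z).

Lemma val_loc_qhatX z : q != 0 -> val (loc_qhatX z) = qhat ^ z.
Proof.
move=> q0; apply: insubdK; apply/asboolP.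
case: z => m; [exists ('X^m : {poly F}, 1) | exists (1, 'X^(m.+1) : {poly F})].
  by rewrite /= (hornerC 1) oner_neq0 tofrac1 divr1 tofracXn.
by rewrite /= hornerXn expf_neq0 // tofrac1 div1r tofracXn.
Qed.

Lemma loc_res_qhatX z : q != 0 -> loc_res (loc_qhatX z) = q ^ z.
Proof.
move=> q0; case: z => m.
  rewrite (@loc_resE _ 'X^m 1) ?hornerC ?oner_neq0 ?val_loc_qhatX //.
    by rewrite divr1 hornerXn.
  by rewrite tofrac1 divr1 tofracXn.
rewrite (@loc_resE _ 1 'X^(m.+1)) ?hornerXn ?expf_neq0 ?val_loc_qhatX //.
  by rewrite hornerC div1r.
by rewrite tofrac1 div1r tofracXn.
Qed.

End LocalRing.

(* Multipartitions of N with l components and their standard tableaux.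
   Rows, columns, components and entries are numbered from 0; the diagram of
   any such multipartition fits in the box 'I_N * 'I_N * 'I_l. *)
Section Tableaux.
Variables (N l : nat).

Definition node : Type := ('I_N * 'I_N * 'I_l)%type.
HB.instance Definition _ := Finite.on node.

Definition row_of (x : node) : 'I_N := x.1.1.
Definition col_of (x : node) : 'I_N := x.1.2.
Definition comp_of (x : node) : 'I_l := x.2.

(* lam m r is the length of row r of component m. *)
Definition multicomp : Type := {ffun 'I_l -> {ffun 'I_N -> 'I_N.+1}}.
HB.instance Definition _ := Finite.on multicomp.

Definition is_multipartition (lam : multicomp) : bool :=
  [forall m : 'I_l, forall r : 'I_N, forall s : 'I_N,
     (r <= s)%N ==> (lam m s <= lam m r)%N]
  && (\sum_(m < l) \sum_(r < N) lam m r == N)%N.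

Definition diagram (lam : multicomp) : {set node} :=
  [set x : node | (col_of x < lam (comp_of x) (row_of x))%N].

Definition tableau : Type := {ffun 'I_N -> node}.
HB.instance Definition _ := Finite.on tableau.

Definition is_standard (lam : multicomp) (t : tableau) : bool :=
  [&& injectiveb t, t @: setT == diagram lam &
   [forall a : 'I_N, forall b : 'I_N,
     (comp_of (t a) == comp_of (t b)) ==>
     ((row_of (t a) == row_of (t b)) && (col_of (t a) < col_of (t b))%N
      || (col_of (t a) == col_of (t b)) && (row_of (t a) < row_of (t b))%N)
     ==> (a < b)%N]].

Definition Std : {set tableau} :=
  [set t | [exists lam, is_multipartition lam && is_standard lam t]].

End Tableaux.

(* The multipartition (0, ..., (N), ..., 0) with (N) in position j. *)
Definition one_row (N l : nat) (j : 'I_l) : multicomp N l :=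
  [ffun m => [ffun r : 'I_N =>
     if (m == j) && (r == 0%N :> nat) then ord_max else ord0]].

Definition one_row_tableau (l : nat) (j : 'I_l) : tableau 2 l :=
  [ffun k => (ord0, k, j)].

Lemma one_row_multipartition (l : nat) (j : 'I_l) :
  is_multipartition (one_row 2 j).
Proof.
apply/andP; split.
  apply/forallP=> m; apply/forallP=> r; apply/forallP=> s; apply/implyP.
  rewrite !ffunE; case: (m == j) => //=.
  by case: (nat_of_ord r) (nat_of_ord s) => [|?] [|?].
rewrite (bigD1 j) //= [X in (_ + X)%N]big1 => [|m /negPf mj].
  by rewrite !big_ord_recl big_ord0 !ffunE eqxx.
by rewrite !big_ord_recl big_ord0 !ffunE mj.
Qed.

Lemma one_row_tableauP (l : nat) (j : 'I_l) (t : tableau 2 l) :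
  is_standard (one_row 2 j) t = (t == one_row_tableau j).
Proof.
have i2 (k : 'I_2) : k = ord0 \/ k = ord_max.
  by case: k => -[|[|]] // i; [left | right]; apply: val_inj.
have dE x : x \in diagram (one_row 2 j) = (x.2 == j) && (x.1.1 == ord0).
  rewrite inE /col_of /row_of /comp_of !ffunE -val_eqE /=.
  by case: ifP => // _; rewrite ltn_ord.
apply/idP/eqP => [/and3P[/injectiveP ti /eqP tD /forallP tS]|->]; last first.
  apply/and3P; split.
  - by apply/injectiveP=> a b; rewrite !ffunE => -[].
  - apply/eqP/setP=> -[[r c] m]; rewrite dE; apply/imsetP/andP => /=.
      by case=> k _; rewrite ffunE => -[-> _ ->].
    by case=> /eqP-> /eqP->; exists c; rewrite ?ffunE.
  - apply/forallP=> a; apply/forallP=> b; rewrite !ffunE /row_of /col_of /=.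
    by rewrite !eqxx ltnn andbF orbF; apply/implyP=> _; apply/implyP.
have tE k : t k = (ord0, (t k).1.2, j).
  have : t k \in diagram (one_row 2 j) by rewrite -tD imset_f.
  by rewrite dE; case: (t k) => [[r c] m] /= /andP[/eqP-> /eqP->].
have lt01 : ((t ord0).1.2 < (t ord_max).1.2)%N.
  case: ltngtP => // [lt10|/val_inj eq01].
    have /forallP/(_ ord0) := tS ord_max; rewrite /comp_of /row_of /col_of.
    by rewrite [t ord_max]tE [t ord0]tE /= !eqxx lt10.
  by have := ti ord0 ord_max; rewrite [t ord_max]tE [t ord0]tE eq01 => /(_ erefl).
have [t0 t1] : (t ord0).1.2 = ord0 /\ (t ord_max).1.2 = ord_max.
  by case: (i2 (t ord0).1.2) (i2 (t ord_max).1.2) lt01 => [] -> [] ->.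
apply/ffunP=> k; rewrite ffunE tE.
by case: (i2 k) => ->; rewrite ?t0 ?t1.
Qed.

Section SeminormalIdempotent.
Variables (F : fieldType) (N l : nat) (khat : 'I_l -> int).

Local Notation K := {fraction {poly F}}.

(* \hat q has formal exponents \hat kappa_m in Z, unlike q whose exponents
   only matter modulo e. *)
Definition heckeK : Type :=
  hecke_alg N (qhat F) (fun m => qhat F ^ khat m).
HB.instance Definition _ := PzAlgebra.on heckeK.

Definition heckeK_gen (g : hecke_index N) : heckeK := hecke_gen _ _ g.

Definition contentK (s : tableau N l) (k : 'I_N) : K :=
  qhat F ^ (khat (comp_of (s k)) + (col_of (s k))%:Z - (row_of (s k))%:Z).

Definition seminormal_idem (s : tableau N l) : heckeK :=
  \prod_(k < N) \prod_(t in Std N l | contentK t k != contentK s k)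
    (((contentK s k - contentK t k)^-1)%:S
     * (heckeK_gen (HL k) - (contentK t k)%:S)).

End SeminormalIdempotent.

Definition central_idempotent (A : pzRingType) (x : A) : Prop :=
  x * x = x /\ forall a : A, a * x = x * a.

Definition primitive_central_idempotent (A : pzRingType) (x : A) : Prop :=
  [/\ central_idempotent x, x <> 0 &
      forall y z : A, central_idempotent y -> central_idempotent z ->
        y * z = 0 -> x = y + z -> y = 0 \/ z = 0].

Lemma root1_neq0 (F : fieldType) (e : nat) (q : F) :
  (1 < e)%N -> q ^+ e = 1 -> q != 0.
Proof.
move=> e1; apply: contra_eq_neq => ->.
by rewrite expr0n gtn_eqF 1?ltnW // eq_sym oner_eq0.
Qed.

Lemma exprz_modZ (F : fieldType) (e : nat) (q : F) (z : int) :
  (1 < e)%N -> q ^+ e = 1 -> q ^ z = q ^+ (z%:~R : 'Z_e).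
Proof.
move=> e1 qe; have qn m : q ^+ (m%:R : 'Z_e) = q ^+ m.
  by rewrite val_Zp_nat // expr_mod.
have q0 := root1_neq0 e1 qe.
case: z => m; first by rewrite -pmulrn qn.
rewrite NegzE mulrNz -pmulrn; apply: (mulIf (expf_neq0 m.+1 q0)).
rewrite -exprnN mulVf ?expf_neq0 // -(qn m.+1) -exprD.
have h (x : 'Z_e) : (((- x)%R + x) %% (Zp_trunc e).+2 = 0)%N.
  by have := congr1 val (addNr x); rewrite /=.
rewrite -(expr_mod _ qe); suff -> : forall a, (a %% e = a %% (Zp_trunc e).+2)%N.
  by rewrite h expr0.
by move=> a; rewrite Zp_cast.
Qed.

Section Specialization.
Variables (F : fieldType) (e l n : nat) (n_gt1 : (1 < n)%N) (q : F).
Variable khat : 'I_l -> int.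

Definition kappa (m : 'I_l) : 'Z_e := (khat m)%:~R.

Definition heckeF : Type := hecke_alg n q (fun m => q ^+ kappa m).
HB.instance Definition _ := PzAlgebra.on heckeF.

Definition heckeF_gen (g : hecke_index n) : heckeF := hecke_gen _ _ g.

Lemma pred2_leq : (2.-1 <= n.-1)%N.
Proof. by case: n n_gt1 => [|[]]. Qed.

(* The elements L_1, L_2, T_1 of H_n. *)
Definition h2_gen (g : hecke_index 2) : heckeF :=
  match g with
  | HL k => heckeF_gen (HL (widen_ord n_gt1 k))
  | HT r => heckeF_gen (HT (widen_ord pred2_leq r))
  end.

Definition hecke2 : Type := subalg h2_gen.
HB.instance Definition _ := PzAlgebra.on hecke2.

Definition hecke2O_rel :=
  @hecke_rel (loc_ring q) l 2 (loc_qhatX q 1) (fun m => loc_qhatX q (khat m)).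

Definition hecke2O : Type := presented hecke2O_rel.
HB.instance Definition _ := PzAlgebra.on hecke2O.

Definition hecke2O_to_K : hecke2O -> heckeK F 2 khat :=
  plift (\val : loc_ring q -> {fraction {poly F}}) (@heckeK_gen F 2 l khat).

(* H_2^O -> H_2^O (x)_O F = H_2, followed by the inclusion in H_n. *)
Definition hecke2O_to_F : hecke2O -> heckeF := plift (loc_res (q:=q)) h2_gen.

Lemma hecke2O_to_K_rel u v : q != 0 -> hecke2O_rel u v ->
  free_eval (\val : loc_ring q -> {fraction {poly F}}) (@heckeK_gen F 2 l khat) u
  = free_eval (\val : loc_ring q -> {fraction {poly F}}) (@heckeK_gen F 2 l khat) v.
Proof.
move=> q0; have qE := val_loc_qhatX 1 q0; rewrite expr1z in qE.
apply: (@hecke_eval_rel _ _ _ _ _ _ _ _ _ 2 (@heckeK_gen F 2 l khat)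
  (fun m => qhat F ^ khat m) id id) => // [u' v'|j].
  by rewrite /= qE; exact: pgen_rel.
exact: val_loc_qhatX.
Qed.

Lemma hecke2O_to_F_rel u v : (1 < e)%N -> q ^+ e = 1 -> hecke2O_rel u v ->
  free_eval (loc_res (q:=q)) h2_gen u = free_eval (loc_res (q:=q)) h2_gen v.
Proof.
move=> e1 qe; have q0 := root1_neq0 e1 qe.
apply: (@hecke_eval_rel _ _ _ _ _ _ _ _ _ n heckeF_gen
  (fun m => q ^+ kappa m) (widen_ord n_gt1) (widen_ord pred2_leq))
  => // [u' v'|j].
  by rewrite /= loc_res_qhatX // expr1z; exact: pgen_rel.
by rewrite /= loc_res_qhatX // (exprz_modZ _ e1 qe).
Qed.

(* The action of the generators of H_2 on the module labelled by one_row 2 j. *)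
Definition one_row_action (j : 'I_l) (g : hecke_index 2) : F :=
  match g with HL k => q ^+ (kappa j + k) | HT _ => q end.

(* In the semisimple algebra H_2 this characterizes e_2^j. *)
Definition is_row_idem (j : 'I_l) (x : hecke2) : Prop :=
  primitive_central_idempotent x /\
  exists chi : {rmorphism hecke2 -> F},
    [/\ forall a : F, chi a%:S = a,
        forall g, chi (sub_gen h2_gen g) = one_row_action j g &
        chi x = 1].

Definition mw_blob : Type :=
  quot_alg (fun z : heckeF =>
    exists (j : 'I_l) (x : hecke2), is_row_idem j x /\ z = val x).
HB.instance Definition _ := PzAlgebra.on mw_blob.

Definition mw_pi : heckeF -> mw_blob := qpi _.

(* Simultaneous generalized eigenspaces of L_1, ..., L_n on the left regular
   module, of which H_n is the direct sum; a weight projector is the projection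
   onto one of them along the others. *)
Definition weight_space (i : residues e n) (v : heckeF) : Prop :=
  forall k : 'I_n, exists N : nat,
    (heckeF_gen (HL k) - (q ^+ i k)%:S) ^+ N * v = 0.

Definition weight_projector (i : residues e n) (x : heckeF) : Prop :=
  [/\ x * x = x,
      forall v, weight_space i (x * v),
      forall v, weight_space i v -> x * v = v &
      forall j v, j != i -> weight_space j v -> x * v = 0].

Definition klrR : Type := klr_alg F n kappa.
HB.instance Definition _ := PzAlgebra.on klrR.

Definition klrR_gen (g : klr_index e n) : klrR := klr_gen _ _ g.

(* These properties determine the Brundan-Kleshchev-Rouquier isomorphism on
   the e(i) and y_k. *)
Definition bkr_morphism (f : klrR -> heckeF) : Prop :=
  [/\ scalar_morphism f,
      forall i, weight_projector i (f (klrR_gen (E i))) &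
      forall k i, f (klrR_gen (Y e k)) * f (klrR_gen (E i)) =
        (1 - (q ^- i k)%:S * heckeF_gen (HL k)) * f (klrR_gen (E i))].

End Specialization.

Definition strongly_adjacency_free (e l n : nat) (khat : 'I_l -> int) : Prop :=
  [/\ forall a b : 'I_l, b = a.+1 :> nat -> (n%:Z <= khat b - khat a)%R,
      forall a b : 'I_l, a != b ->
        [/\ kappa e khat a - kappa e khat b != 0,
            kappa e khat a - kappa e khat b != 1 &
            kappa e khat a - kappa e khat b != -1],
      forall a b : 'I_l, a = 0%N :> nat -> b = l.-1 :> nat ->
        kappa e khat a != kappa e khat b + 2%:R &
      forall a b : 'I_l, (a < b)%N -> (kappa e khat a < kappa e khat b)%N].

(* Main.v *)
Require Import Defs.
From HB Require Import structures.
From mathcomp Require Import all_boot all_order all_algebra.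
From mathcomp Require Import ring boolp fraction monalg.

(** Write Q_m = q^kappa_m. By adjacency-freeness the pairs of contents of the
    standard tableaux of size 2 stay distinct after reduction to F, and so do
    the possible second contents once the component of the entry 1 is fixed.
    Hence H_2 decomposes by weights of (L_1, L_2) already over the local ring O:
    there are commuting idempotents E_s, one for each weight s, with sum 1 and
    L_k E_s = s_k E_s (joint_projectors). The one nontrivial input is that,
    where L_1 = Q_m, the eigenvalues of L_2 are q Q_m, q^-1 Q_m and the Q_m'
    with m' <> m (second_kill); it comes from the square of the intertwiner of
    L_1 and L_2.

    Over K the seminormal element acts on each E_s by a scalar, which is 1 on
    the weight of the row in component j and 0 elsewhere, so it equals that E_s
    (seminormal_projector) and lies in the O-form. Its preimage is unique
    because the O-form has no torsion (base_change_inj): E_s H_2 is spanned by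
    E_s and E_s T, and a module of dimension one or two of H_2^K detects the
    coefficients.

    In H_n the images of the E_s are eigenprojectors for L_1 and L_2, and the
    f(e(i)) have sum 1 and lie in generalized eigenspaces of the L_k. Comparing
    the two resolutions of 1 shows that E_s is the sum of the f(e(i)) with
    (i_1, i_2) = s (projector_weight_sum), which is the formula for
    f^-1 of the seminormal idempotent.

    For the quotients: H_2 acts on the row idempotent through the trivial
    character, which is the restriction of the trivial character of H_n and
    therefore survives in the subalgebra H_2 of H_n. This makes it the only
    primitive central idempotent on which that character is 1 (row_idemP). So the
    ideal of the quotient of H_n is generated by the elements
    f(sum of the e(i) with i_1 = kappa_j and i_2 = kappa_j + 1), and since the
    e(i) are orthogonal this is the image of the ideal generated by the
    e(i) with i_1 = kappa_j and i_2 = i_1 + 1. *)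

Set Implicit Arguments.
Unset Strict Implicit.
Unset Printing Implicit Defensive.

Import GRing.Theory.
Local Open Scope ring_scope.

(** * Eigenspace decompositions over a commutative ring *)

Section Scalars.
Variables (R : comUnitRingType) (A : pzAlgType R).
Implicit Types (a b : R) (x y z v w : A).

Lemma scalCA x a y : x * (a%:S * y) = a%:S * (x * y).
Proof. by rewrite !mulrA scalC. Qed.

Lemma scalKu a x : a \is a GRing.unit -> a%:S * x = 0 -> x = 0.
Proof.
move=> ua ax0; have: (a^-1)%:S * (a%:S * x) = 0 by rewrite ax0 mulr0.
by rewrite mulrA -rmorphM mulVr // rmorph1 mul1r.
Qed.

Lemma prod_actl (I : Type) (s : seq I) (P : pred I) (f : I -> A) (a : I -> R) v :
  (forall i, P i -> f i * v = (a i)%:S * v) ->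
  (\prod_(i <- s | P i) f i) * v = (\prod_(i <- s | P i) a i)%:S * v.
Proof.
move=> fv; elim: s => [|i s IHs]; first by rewrite !big_nil rmorph1.
rewrite !big_cons; case: ifP => // /fv fi.
by rewrite -mulrA IHs scalCA fi mulrA -rmorphM mulrC.
Qed.

Lemma prod_actr (I : Type) (s : seq I) (P : pred I) (f : I -> A) (a : I -> R) v :
  (forall i, P i -> v * f i = (a i)%:S * v) ->
  v * (\prod_(i <- s | P i) f i) = (\prod_(i <- s | P i) a i)%:S * v.
Proof.
move=> fv; elim: s => [|i s IHs]; first by rewrite !big_nil mulr1 rmorph1 mul1r.
rewrite !big_cons; case: ifP => // /fv fi.
by rewrite mulrA fi -mulrA IHs mulrA -rmorphM.
Qed.

Lemma eigen_orth a b x v w : GRing.comm x v -> x * v = a%:S * v ->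
  x * w = b%:S * w -> a - b \is a GRing.unit -> v * w = 0.
Proof.
move=> xv va wb /scalKu; apply.
by rewrite rmorphB mulrBl mulrA -va xv -mulrA wb scalCA subrr.
Qed.

(** Moves one factor to the right end: polynomials in a single x commute even
    though the ring does not. *)
Lemma prod_rem (C : eqType) (r : C -> R) x (s : seq C) c : c \in s ->
  \prod_(d <- s) (x - (r d)%:S) =
  \prod_(d <- rem c s) (x - (r d)%:S) * (x - (r c)%:S).
Proof.
elim: s => //= d s IHs; rewrite in_cons eq_sym big_cons.
case: (eqVneq d c) => [-> _|_ /= /IHs->]; last by rewrite big_cons mulrA.
apply: commr_prod => d' _; apply/commr_sym/commrB.
  by apply/commr_sym/commrB => //; apply: commr_sym; exact: scalC.
by apply: commr_sym; exact: scalC.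
Qed.

(** By induction on s: decompose (x - r c) v along the remaining eigenvalues and
    divide the d-component by r d - r c; what is left of v is its c-component.
    Only differences of eigenvalues are inverted, so the coefficients need not
    form a field. The last two clauses replace the statement that each
    component is a polynomial in x applied to v. *)
Lemma spectral_split (C : eqType) (r : C -> R) x (s : seq C) v :
  uniq s ->
  (forall c d, c \in s -> d \in s -> c != d -> r c - r d \is a GRing.unit) ->
  \prod_(c <- s) (x - (r c)%:S) * v = 0 ->
  exists E : C -> A,
    [/\ \sum_(c <- s) E c = v,
        {in s, forall c, x * E c = (r c)%:S * E c},
        forall z, GRing.comm z x -> GRing.comm z v ->
          forall c, GRing.comm z (E c) &
        forall z, GRing.comm z x -> z * v = 0 -> forall c, z * E c = 0].
Proof.
elim: s v => [|c s IHs] v /=.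
  rewrite !big_nil mul1r => _ _ ->; exists (fun=> 0).
  by split=> [|//|z _ _ _|z _ _ _]; rewrite ?big_nil ?mulr0 //; exact: commr0.
case/andP=> cs us ru; rewrite big_cons => kv.
pose v' := (x - (r c)%:S) * v.
have Cx d : GRing.comm x (x - (r d)%:S).
  by apply: commrB => //; apply: commr_sym; exact: scalC.
have kv' : \prod_(d <- s) (x - (r d)%:S) * v' = 0.
  rewrite mulrA -[RHS]kv; congr (_ * v); apply: commr_sym.
  apply: commr_prod => d _; apply: commr_sym; apply: commrB.
    exact/commr_sym/Cx.
  by apply: commr_sym; exact: scalC.
have [|E' [E's E'x E'C E'0]] := IHs v' us _ kv'.
  by move=> d d' ds ds'; apply: ru; rewrite in_cons (ds, ds') orbT.
have ud d : d \in s -> r d - r c \is a GRing.unit.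
  move=> ds; apply: ru; rewrite ?in_cons ?eqxx ?ds ?orbT //.
  by apply: contraNneq cs => <-.
pose E0 d := ((r d - r c)^-1)%:S * E' d.
pose E d := if d == c then v - \sum_(d <- s) E0 d else E0 d.
have EE d : d \in s -> E d = E0 d.
  by rewrite /E; case: eqP => // ->; rewrite (negPf cs).
have sE : \sum_(d <- s) E d = \sum_(d <- s) E0 d.
  by rewrite big_seq [RHS]big_seq; exact: eq_bigr.
exists E; split.
- by rewrite big_cons sE {1}/E eqxx subrK.
- move=> d; rewrite in_cons => /orP[/eqP->|ds]; last first.
    by rewrite EE // /E0 scalCA E'x // !mulrA -!rmorphM mulrC.
  apply/eqP; rewrite -subr_eq0 -mulrBl /E eqxx mulrBr -/v' -E's mulr_sumr.
  rewrite -sumrB big_seq big1 // => d' ds.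
  rewrite /E0 scalCA mulrBl E'x // -mulrBl mulrA -rmorphB -rmorphM.
  by rewrite mulVr ?ud // rmorph1 mul1r subrr.
- move=> z zx zv d.
  have zE0 d' : GRing.comm z (E0 d').
    apply: commrM; first by apply: commr_sym; exact: scalC.
    apply: E'C => //; apply: commrM => //; apply: commrB => //.
    by apply: commr_sym; exact: scalC.
  by rewrite /E; case: eqP => // _; apply: commrB => //; apply: commr_sum.
- move=> z zx zv0 d.
  have zE0 d' : z * E0 d' = 0.
    rewrite /E0 scalCA E'0 ?mulr0 // /v' mulrA.
    have -> : z * (x - (r c)%:S) = (x - (r c)%:S) * z.
      by apply: commrB => //; apply: commr_sym; exact: scalC.
    by rewrite -mulrA zv0 mulr0.
  rewrite /E; case: eqP => // _.
  by rewrite mulrBr zv0 mulr_sumr big1 ?subr0.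
Qed.

End Scalars.

(** * Affine Hecke relations in rank two *)

Section RankTwo.
Variables (R : comUnitRingType) (l : nat) (q : R) (Q : 'I_l -> R).
Variables (A : pzAlgType R) (L1 L2 T : A).
Hypothesis cyc : \prod_(m < l) (L1 - (Q m)%:S) = 0.
Hypothesis quad : (T + 1) * (T - q%:S) = 0.
Hypothesis L12 : L1 * L2 = L2 * L1.
Hypothesis TL1 : T * L1 = L2 * (T - q%:S + 1).
Hypothesis qU : q \is a GRing.unit.

Variable p : R.
Hypothesis pE : p = q - 1.

Lemma heckeTT : T * T = p%:S * T + q%:S.
Proof.
apply/eqP; rewrite -subr_eq0 -[X in _ == X]quad mulrDl mul1r mulrBr; apply/eqP.
rewrite pE rmorphB rmorph1 mulrBl mul1r -(scalC q T).
by rewrite opprD opprB !addrA; congr (_ - _); rewrite -!addrA; congr (_ + _); rewrite addrC.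
Qed.

Lemma heckeTL1 : T * L1 = L2 * T - p%:S * L2.
Proof.
rewrite pE TL1 mulrDr mulrBr mulr1 rmorphB rmorph1 mulrBl mul1r opprB.
by rewrite -(scalC q) addrA addrAC.
Qed.

(** T - p is q times the inverse of T, so the relation for T L1 can be conjugated. *)
Lemma heckeL1T : L1 * T = T * L2 - p%:S * L2.
Proof.
have Tp : (T - p%:S) * T = q%:S by rewrite mulrBl heckeTT addrAC subrr add0r.
have qC : (T - p%:S) * (L2 * q%:S) = q%:S * ((T - p%:S) * L2).
  by rewrite mulrA -scalC.
apply/eqP; rewrite -subr_eq0; apply/eqP; apply: (scalKu qU); rewrite mulrBr.
rewrite -{1}Tp -(mulrA _ T) (mulrA T) heckeTL1 (scalC p L2) -mulrBr.
rewrite -(mulrA L2) Tp qC mulrBl.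
by rewrite (scalC p L2) subrr.
Qed.

Lemma heckeTL2 : T * L2 = L1 * T + p%:S * L2.
Proof. by rewrite heckeL1T subrK. Qed.

(* The intertwiner of L1 and L2, normalized without denominators. *)
Let phi := T * (L1 - L2) + p%:S * L2.

Lemma intertwiner_L1 : phi * L1 = L2 * phi.
Proof.
have C : (L1 - L2) * L1 = L1 * (L1 - L2) by rewrite mulrBl mulrBr L12.
rewrite /phi mulrDl -(mulrA T) C (mulrA T) heckeTL1 mulrBl (mulrDr L2) -!mulrA.
rewrite (scalCA L2) -addrA; congr (_ + _).
by rewrite addrC -mulrBr -mulrBr subKr.
Qed.

Lemma intertwiner_L2 : phi * L2 = L1 * phi.
Proof.
have C : (L1 - L2) * L2 = L2 * (L1 - L2) by rewrite mulrBl mulrBr L12.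
rewrite /phi mulrDl -(mulrA T) C (mulrA T) heckeTL2 mulrDl (mulrDr L1) -!mulrA.
rewrite (scalCA L1) -addrA; congr (_ + _).
by rewrite -mulrDr -mulrDr subrK L12.
Qed.

Lemma intertwiner_sqr :
  phi * phi = q%:S * ((L1 - L2) * (L2 - L1)) + p%:S * (p%:S * (L2 * L1)).
Proof.
have Tphi : T * phi = p%:S * (T * L1) + q%:S * (L1 - L2).
  rewrite /phi mulrDr mulrA heckeTT mulrDl (scalCA T) -mulrA addrAC.
  by rewrite -mulrDr -mulrDr subrK.
have Lphi : (L1 - L2) * phi = phi * (L2 - L1).
  by rewrite mulrBl mulrBr intertwiner_L1 intertwiner_L2.
rewrite {1}/phi mulrDl -(mulrA T) Lphi (mulrA T) Tphi -(mulrA p%:S) -intertwiner_L1.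
rewrite mulrDl -!mulrA addrAC addrC; congr (_ + _).
rewrite -mulrDr; congr (_ * _); rewrite /phi mulrDl addrA -!mulrA -mulrDr.
by rewrite mulrBl mulrBr L12 subrKA subrr mulr0 add0r.
Qed.

(** Where L1 = a the polynomial intertwiner_sqr in L2 factors, with roots q a
    and q^-1 a: the contents next to a in a row and in a column. *)
Lemma intertwiner_sqr_eigen a v : L1 * v = a%:S * v ->
  phi * phi * v =
  (- q)%:S * ((L2 - (q * a)%:S) * ((L2 - (q^-1 * a)%:S) * v)).
Proof.
move=> va; pose w := L2 * v; pose x := L2 * w.
have L1w : L1 * w = a%:S * w by rewrite mulrA L12 -mulrA va scalCA.
(* Both sides are compared by their coefficients on L2^2 v, L2 v and v. *)
pose cb (b c d : R) := b%:S * x + c%:S * w + d%:S * v.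
have cbD b c d b' c' d' : cb b c d + cb b' c' d' = cb (b + b') (c + c') (d + d').
  by rewrite /cb !rmorphD !mulrDl addrACA; congr (_ + _); rewrite addrACA.
have cbZ k b c d : k%:S * cb b c d = cb (k * b) (k * c) (k * d).
  by rewrite /cb !mulrDr !mulrA -!rmorphM.
have L2cb c d : L2 * cb 0 c d = cb c d 0.
  by rewrite /cb rmorph0 !mul0r add0r addr0 mulrDr !scalCA.
have L1cb c d : L1 * cb 0 c d = cb 0 (a * c) (a * d).
  rewrite /cb rmorph0 !mul0r !add0r mulrDr !scalCA L1w va.
  by rewrite !mulrA -!rmorphM !(mulrC a).
have vE : v = cb 0 0 1 by rewrite /cb rmorph0 rmorph1 !mul0r !add0r mul1r.
have BE (b c : A) (y : A) : (b - c) * y = b * y + (-1)%:S * (c * y).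
  by rewrite mulrBl rmorphN rmorph1 mulN1r.
rewrite intertwiner_sqr mulrDl -!mulrA vE.
rewrite !(BE, L1cb, L2cb, cbZ, cbD, mulr0, mulr1, addr0, add0r).
have qa : q * (q^-1 * a) = a by rewrite mulrA mulrV // mul1r.
congr cb; [ring | ring: pE qa | ring: qa].
Qed.

Hypothesis pU : p \is a GRing.unit.
Hypothesis QU : forall m, Q m \is a GRing.unit.
Hypothesis QQU : forall m m', m != m' -> Q m - Q m' \is a GRing.unit.

(** The content of the entry 2 when the entry 1 lies in component m: None is the
    column of component m, Some m its row, and Some m' with m' <> m puts the
    entry 2 in component m'. *)
Definition second_weight (m : 'I_l) (c : option 'I_l) : R :=
  if c is Some m' then if m' == m then q * Q m else Q m' else q^-1 * Q m.

Hypothesis wU : forall m c d, c != d ->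
  second_weight m c - second_weight m d \is a GRing.unit.

Lemma scal_commr a (x : A) : GRing.comm x a%:S.
Proof. exact/esym/scalC. Qed.

Lemma first_projectors : exists E : 'I_l -> A,
  [/\ \sum_m E m = 1, forall m, L1 * E m = (Q m)%:S * E m,
      forall m, GRing.comm L1 (E m) & forall m, GRing.comm L2 (E m)].
Proof.
have [|c d _ _||E [E1 EL1 EC _]] :=
  @spectral_split R A _ Q L1 (index_enum 'I_l) 1.
- exact: index_enum_uniq.
- exact: QQU.
- by rewrite cyc mul0r.
exists E; split=> // m; first exact/EL1/mem_index_enum.
  by apply: EC => //; exact: commr1.
by apply: EC; [exact/esym|exact: commr1].
Qed.

Lemma prod_intertwiner (s : seq 'I_l) :
  \prod_(m <- s) (L2 - (Q m)%:S) * phi = phi * \prod_(m <- s) (L1 - (Q m)%:S).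
Proof.
elim: s => [|m s IHs]; first by rewrite !big_nil mul1r mulr1.
rewrite !big_cons -mulrA IHs !mulrA; congr (_ * _).
by rewrite mulrBl mulrBr intertwiner_L1 (scal_commr _ phi).
Qed.

(** The cyclotomic polynomial g satisfies g(L2) phi = phi g(L1) = 0, so g(L2)
    kills phi^2 E, which gives the product below with one extra factor
    L2 - Q m. To remove it, let N be the product below: L1 and L2 both act on N
    by Q m, hence (L1 - Q m) T N = - p (Q m) N. Multiplying by E, which
    annihilates L1 - Q m and fixes N, leaves N = 0. The extra factor is thus
    excluded because entries 1 and 2 cannot have the same content. *)
Lemma second_kill m (E : A) : L1 * E = (Q m)%:S * E -> GRing.comm L1 E ->
  GRing.comm L2 E -> E * E = E ->
  \prod_(m' <- rem m (index_enum 'I_l)) (L2 - (Q m')%:S)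
    * ((L2 - (q * Q m)%:S) * ((L2 - (q^-1 * Q m)%:S) * E)) = 0.
Proof.
move=> EL1 EC1 EC2 EE; set P := \prod_(m' <- _) _.
set X := P * ((L2 - (q * Q m)%:S) * (L2 - (q^-1 * Q m)%:S)).
have subC (z : A) a : GRing.comm z L2 -> GRing.comm z (L2 - a%:S).
  by move=> zL; apply: commrB => //; exact: scal_commr.
have PC (z : A) : GRing.comm z L2 -> GRing.comm z P.
  by move=> zL; apply: commr_prod => m' _; exact: subC.
have XC (z : A) : GRing.comm z L2 -> GRing.comm z X.
  by move=> zL; do 2?apply: commrM; [exact: PC|exact: subC|exact: subC].
have XE : P * ((L2 - (q * Q m)%:S) * ((L2 - (q^-1 * Q m)%:S) * E)) = X * E.
  by rewrite /X -!mulrA.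
rewrite XE; set N := X * E.
have L1N : L1 * N = (Q m)%:S * N.
  by rewrite mulrA (XC _ L12) -mulrA EL1 scalCA.
have L2N : L2 * N = (Q m)%:S * N.
  apply/eqP; rewrite -subr_eq0 -mulrBl /N -XE (mulrA _ P).
  rewrite (_ : _ * P = P * (L2 - (Q m)%:S)); last first.
    by apply/esym/subC; exact/esym/PC.
  rewrite -prod_rem ?mem_index_enum //; apply/eqP.
  have uN : - q \is a GRing.unit by rewrite unitrN.
  apply: (scalKu uN); rewrite -scalCA -intertwiner_sqr_eigen // -!mulrA (mulrA _ phi).
  by rewrite prod_intertwiner cyc mulr0 mul0r.
have EN : E * N = N by rewrite mulrA (XC E) -?mulrA ?EE //; exact/esym.
have : E * (L1 * (T * N)) = (Q m)%:S * (E * (T * N)).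
  by rewrite mulrA -EC1 EL1 -mulrA.
rewrite (mulrA L1) heckeL1T mulrBl -(mulrA T) L2N -(mulrA p%:S) L2N.
rewrite mulrBr (scalCA T) !(scalCA E) EN => /eqP.
rewrite -subr_eq0 addrAC subrr add0r oppr_eq0.
by move/eqP/(scalKu pU)/(scalKu (QU m)).
Qed.

(** 1 is split along L1, and then each component along L2. *)
Theorem joint_projectors : exists E : 'I_l -> option 'I_l -> A,
  [/\ \sum_m \sum_c E m c = 1,
      forall m c, L1 * E m c = (Q m)%:S * E m c,
      forall m c, L2 * E m c = (second_weight m c)%:S * E m c,
      forall m c, GRing.comm L1 (E m c) & forall m c, GRing.comm L2 (E m c)].
Proof.
have [E [E1 EL1 EC1 EC2]] := first_projectors.
have EE m : E m * E m = E m.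
  rewrite -[RHS]mulr1 -E1 mulr_sumr (bigD1 m) //= big1 ?addr0 // => m' m'm.
  apply: (eigen_orth (EC1 m) (EL1 m) (EL1 m')).
  by apply: QQU; rewrite eq_sym.
have : forall m, exists G : option 'I_l -> A,
   [/\ \sum_c G c = E m,
       forall c, L2 * G c = (second_weight m c)%:S * G c,
       forall c, GRing.comm L1 (G c), forall c, GRing.comm L2 (G c) &
       forall c, L1 * G c = (Q m)%:S * G c].
  (* The eigenvalues Q m' with m' <> m come first, matching second_kill. *)
  move=> m; pose s := rcons (rcons (map Some (rem m (index_enum 'I_l))) (Some m)) None.
  have us : uniq s.
    rewrite !rcons_uniq mem_rcons in_cons /=.
    rewrite map_inj_uniq ?rem_uniq ?index_enum_uniq //; last by move=> ? ? [].
    rewrite mem_map; last by move=> ? ? [].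
    rewrite mem_rem_uniq ?index_enum_uniq // inE eqxx /= andbT.
    by apply/mapP=> -[].
  have sT : perm_eq s (index_enum (option 'I_l)).
    apply: uniq_perm => //; first exact: index_enum_uniq.
    move=> c; rewrite mem_index_enum !mem_rcons !in_cons mem_rcons in_cons.
    case: c => [c|] //=; rewrite mem_map; last by move=> ? ? [].
    rewrite mem_rem_uniq ?index_enum_uniq // inE /= mem_index_enum andbT.
    by rewrite (_ : (Some c == Some m) = (c == m)) ?orbN //; case: eqP.
  have [|c d _ _ cd||G [GE GL GC G0]] := @spectral_split R A _ (second_weight m) L2 s (E m).
  - by [].
  - exact: wU.
  - rewrite /s -!cats1 !big_cat !big_seq1 /= eqxx big_map -!mulrA.
    rewrite big_seq (eq_bigr (fun m' => L2 - (Q m')%:S)); last first.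
      move=> m'; rewrite mem_rem_uniq ?index_enum_uniq // inE => /andP[+ _].
      by rewrite /= => /negPf->.
    by rewrite -big_seq second_kill.
  exists G; split.
  - by rewrite -(perm_big _ sT).
  - by move=> c; apply: GL; rewrite (perm_mem sT) mem_index_enum.
  - by move=> c; apply: GC => //; exact: EC1.
  - by move=> c; apply: GC => //; exact: EC2.
  - move=> c; apply/eqP; rewrite -subr_eq0 -mulrBl G0 //.
      by apply/commr_sym/commrB; [exact/esym|exact: scal_commr].
    by rewrite mulrBl EL1 subrr.
move/fin_all_exists=> [G GP]; exists G; split=> [|m c|m c|m c|m c].
  by rewrite -E1; apply: eq_bigr => m _; case: (GP m).
all: by case: (GP m).
Qed.

(** The condition on t says that v (T - t) is an eigenvector of L1 for s2, which
    is not a root of the cyclotomic polynomial. It holds for t = q, s2 = q s1 and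
    for t = -1, s2 = q^-1 s1. *)
Lemma eigen_Tr v s1 s2 t : v * L1 = s1%:S * v -> v * L2 = s2%:S * v ->
  t * s2 = p * s2 + t * s1 -> (forall m, s2 - Q m \is a GRing.unit) ->
  v * T = t%:S * v.
Proof.
move=> v1 v2 ts sU; apply/eqP; rewrite -subr_eq0; apply/eqP.
set u := v * T - _; have uL1 : u * L1 = s2%:S * u.
  rewrite mulrBl -mulrA heckeTL1 -(mulrA t%:S) v1 mulrBr !mulrA v2.
  rewrite -(scalC p v) -(mulrA p%:S) v2 -(mulrA s2%:S) /u mulrBr -!addrA.
  congr (_ + _); rewrite !mulrA -!rmorphM -opprD -mulrDl -rmorphD.
  by rewrite -ts mulrC.
have uU : \prod_(m < l) (s2 - Q m) \is a GRing.unit by apply: rpred_prod => m _.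
apply: (scalKu uU).
have := @prod_actr R A _ (index_enum 'I_l) xpredT (fun m => L1 - (Q m)%:S)
  (fun m => s2 - Q m) u; rewrite cyc mulr0 => <- //.
by move=> m _; rewrite mulrBr uL1 -scalC -mulrBl rmorphB.
Qed.

Lemma eigen_Tl v s1 s2 t : L1 * v = s1%:S * v -> L2 * v = s2%:S * v ->
  t * s2 = p * s2 + t * s1 -> (forall m, s2 - Q m \is a GRing.unit) ->
  T * v = t%:S * v.
Proof.
move=> v1 v2 ts sU; apply/eqP; rewrite -subr_eq0; apply/eqP.
set u := T * v - _; have uL1 : L1 * u = s2%:S * u.
  rewrite mulrBr mulrA heckeL1T scalCA v1 mulrBl -!mulrA v2.
  rewrite (scalCA T) /u mulrBr -!addrA.
  congr (_ + _); rewrite !mulrA -!rmorphM -opprD -mulrDl -rmorphD.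
  by rewrite -ts mulrC.
have uU : \prod_(m < l) (s2 - Q m) \is a GRing.unit by apply: rpred_prod => m _.
apply: (scalKu uU).
have := @prod_actl R A _ (index_enum 'I_l) xpredT (fun m => L1 - (Q m)%:S)
  (fun m => s2 - Q m) u; rewrite cyc mul0r => <- //.
by move=> m _; rewrite mulrBl uL1 -mulrBl rmorphB.
Qed.

Section RightSpan.
Variables (v : A) (s1 s2 : R).
Hypotheses (v1 : v * L1 = s1%:S * v) (v2 : v * L2 = s2%:S * v).

(** v H_2 is spanned by v and v T when v is a weight vector. *)
Definition right_span x := exists a b : R, v * x = a%:S * v + b%:S * (v * T).

Lemma right_span1 : right_span 1.
Proof. by exists 1, 0; rewrite rmorph0 rmorph1 mul0r addr0 mulr1 mul1r. Qed.

Lemma right_spanD x y : right_span x -> right_span y -> right_span (x + y).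
Proof.
move=> [a [b xE]] [a' [b' yE]]; exists (a + a'), (b + b').
by rewrite mulrDr xE yE !rmorphD !mulrDl addrACA.
Qed.

Lemma right_spanZ a x : right_span x -> right_span (a%:S * x).
Proof.
move=> [b [c xE]]; exists (a * b), (a * c).
by rewrite scalCA xE mulrDr !mulrA -!rmorphM.
Qed.

Let vTL1 : v * T * L1 = s2%:S * (v * T) - (p * s2)%:S * v.
Proof. by rewrite -mulrA heckeTL1 mulrBr mulrA v2 scalCA v2 !mulrA -rmorphM. Qed.

Let vTL2 : v * T * L2 = s1%:S * (v * T) + (p * s2)%:S * v.
Proof. by rewrite -mulrA heckeTL2 mulrDr mulrA v1 scalCA v2 !mulrA -rmorphM. Qed.

Let vTT : v * T * T = p%:S * (v * T) + q%:S * v.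
Proof. by rewrite -mulrA heckeTT mulrDr scalCA -scalC. Qed.

Lemma right_spanL1 x : right_span x -> right_span (x * L1).
Proof.
move=> [a [b xE]]; exists (a * s1 - b * (p * s2)), (b * s2).
rewrite mulrA xE mulrDl -!mulrA v1 (mulrA v) vTL1.
rewrite [in RHS]rmorphB mulrBl !(rmorphM _ a) !(rmorphM _ b).
by rewrite -(mulrA a%:S) -!(mulrA b%:S) mulrBr addrA addrAC.
Qed.

Lemma right_spanL2 x : right_span x -> right_span (x * L2).
Proof.
move=> [a [b xE]]; exists (a * s2 + b * (p * s2)), (b * s1).
rewrite mulrA xE mulrDl -!mulrA v2 (mulrA v) vTL2.
rewrite [in RHS]rmorphD mulrDl !(rmorphM _ a) !(rmorphM _ b).
by rewrite -(mulrA a%:S) -!(mulrA b%:S) mulrDr addrA addrAC.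
Qed.

Lemma right_spanT x : right_span x -> right_span (x * T).
Proof.
move=> [a [b xE]]; exists (b * q), (a + b * p).
rewrite mulrA xE mulrDl -!mulrA (mulrA v T) vTT.
rewrite [in RHS]rmorphD mulrDl !(rmorphM _ b).
by rewrite -!(mulrA b%:S) mulrDr addrA addrC.
Qed.

End RightSpan.

End RankTwo.

(** * Presented algebras and the local ring *)

Section Presented.
Variables (R : comNzRingType) (X : choiceType).
Variable rel : free_alg R X -> free_alg R X -> Prop.

(** Words grow on the right, as needed for cyclic right modules. *)
Lemma presented_ind (P : presented rel -> Prop) :
  P 1 -> (forall x y, P x -> P y -> P (x + y)) ->
  (forall a x, P x -> P (a%:S * x)) -> (forall x g, P x -> P (x * pgen rel g)) ->
  forall x, P x.
Proof.
move=> P1 PD PZ Pg x; rewrite -[x]qpi_repr -free_eval_pgen free_evalEsum.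
have P0 : P 0 by have := PZ 0 1 P1; rewrite rmorph0 mul0r.
apply: (big_ind P) => // m _; apply: PZ; rewrite /monom_eval.
elim/last_ind: (m : seq X) => [|s g IHs]; first by rewrite big_nil.
by rewrite -cats1 big_cat big_seq1; exact: Pg.
Qed.

Variables (S : comNzRingType) (sigma : {rmorphism R -> S}).
Variables (A : pzAlgType S) (phi : X -> A).
Hypothesis phi_rel : forall u v, rel u v ->
  free_eval sigma phi u = free_eval sigma phi v.

Definition lift_morphism : {rmorphism presented rel -> A} :=
  HB.pack (plift sigma phi : presented rel -> A)
    (GRing.isZmodMorphism.Build _ _ _ (plift_zmod_morphism phi_rel))
    (GRing.isMonoidMorphism.Build _ _ _ (plift_monoid_morphism phi_rel)).

Lemma lift_morphismE : lift_morphism =1 plift sigma phi.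
Proof. by []. Qed.

End Presented.

Section LocUnit.
Variables (F : fieldType) (q : F).
Local Notation O := (loc_ring q).

Definition loc_unit : {pred O} := fun x => loc_res x != 0.

Lemma loc_inv_subproof (x : O) : x \in loc_unit -> (val x)^-1 \in loc_pred q.
Proof.
have [a [b [b0 xE xq]]] := loc_repr x; rewrite unfold_in xq => ab0.
apply/asboolP; exists (b, a) => /=; split; last by rewrite xE invf_div.
by apply: contraNneq ab0 => ->; rewrite mul0r.
Qed.

Definition loc_inv (x : O) : O :=
  if x \in loc_unit then insubd 0 (val x)^-1 else x.

Lemma loc_mulVx : {in loc_unit, left_inverse 1 loc_inv *%R}.
Proof.
move=> x xU; have vE : val (insubd 0 (val x)^-1 : O) = (val x)^-1.
  exact/insubdK/loc_inv_subproof.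
apply: val_inj; rewrite rmorphM /= /loc_inv xU.
rewrite [X in X * _]vE mulVf //; apply/eqP => x0.
by move: xU; rewrite unfold_in (_ : x = 0) ?rmorph0 ?eqxx //; exact: val_inj.
Qed.

Lemma loc_unitPl (x y : O) : y * x = 1 -> loc_unit x.
Proof.
move/(congr1 (loc_res (q:=q))); rewrite rmorphM rmorph1 => xy.
apply/eqP => x0; move: xy; rewrite [X in _ * X]x0 mulr0 => /eqP.
by rewrite eq_sym oner_eq0.
Qed.

Lemma loc_inv_out : {in [predC loc_unit], loc_inv =1 id}.
Proof. by move=> x; rewrite /loc_inv inE /= => /negPf->. Qed.

HB.instance Definition _ := GRing.ComNzRing_hasMulInverse.Build O
  loc_mulVx loc_unitPl loc_inv_out.

Lemma loc_unitE (x : O) : (x \is a GRing.unit) = (loc_res x != 0).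
Proof. by []. Qed.

End LocUnit.

Section Regular.
Variable R : comNzRingType.
Lemma regular_scalC (a : R) (x : R^o) : idfun a * x = x * idfun a.
Proof. exact: mulrC. Qed.
HB.instance Definition _ := PzRing_isAlgebra.Build R R^o regular_scalC.

Lemma matrix_scalC n (a : R) (x : 'M[R]_n.+1) : a%:M * x = x * a%:M.
Proof. exact/esym/scalar_mxC. Qed.
HB.instance Definition _ n := PzRing_isAlgebra.Build R 'M[R]_n.+1 (@matrix_scalC n).
End Regular.

(** * Modules of the Hecke algebra *)

Lemma I2P (k : 'I_2) : k = ord0 \/ k = ord_max.
Proof. by case: k => -[|[|//]] ?; [left|right]; apply: val_inj. Qed.

Section RankTwoRelations.
Variables (R : comNzRingType) (l : nat) (q : R) (Q : 'I_l -> R).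
Variables (A : pzAlgType R) (phi : hecke_index 2 -> A).
Hypothesis phi_rel : forall u v, hecke_rel q Q u v ->
  free_eval idfun phi u = free_eval idfun phi v.

Lemma lo_I2 : lo (ord0 : 'I_2.-1) = ord0. Proof. exact: val_inj. Qed.
Lemma hi_I2 : hi (ord0 : 'I_2.-1) = ord_max. Proof. exact: val_inj. Qed.

Lemma rank2_cyc : \prod_(m < l) (phi (HL ord0) - (Q m)%:S) = 0.
Proof.
have := phi_rel (hecke_cyc q Q (erefl : (ord0 : 'I_2) = 0%N :> nat)).
rewrite free_eval0 => <-; rewrite rmorph_prod; apply: eq_bigr => m _ /=.
by rewrite free_evalD free_evalN free_eval_gen free_eval_scal.
Qed.

Lemma rank2_quad : (phi (HT (ord0 : 'I_2.-1)) + 1) * (phi (HT (ord0 : 'I_2.-1)) - q%:S) = 0.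
Proof. by have := phi_rel (hecke_quad q Q (ord0 : 'I_2.-1)); rewrite !free_evalE. Qed.

Lemma rank2_LL :
  phi (HL ord0) * phi (HL ord_max) = phi (HL ord_max) * phi (HL ord0).
Proof. by have := phi_rel (hecke_LL q Q ord0 ord_max); rewrite !free_evalM !free_eval_gen. Qed.

Lemma rank2_TL : phi (HT (ord0 : 'I_2.-1)) * phi (HL ord0) =
  phi (HL ord_max) * (phi (HT (ord0 : 'I_2.-1)) - q%:S + 1).
Proof.
by have := phi_rel (hecke_TLlo q Q (ord0 : 'I_2.-1)); rewrite lo_I2 hi_I2 !free_evalE.
Qed.

End RankTwoRelations.

Section HeckeRelations.
Variables (R : comNzRingType) (l n : nat) (q : R) (Q : 'I_l -> R).
Variables (A : pzAlgType R) (phi : hecke_index n -> A).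

(** Reduces the verification of the Hecke relations to identities in the target
    algebra. *)
Lemma hecke_relP :
  (forall k : 'I_n, k = 0%N :> nat -> \prod_(m < l) (phi (HL k) - (Q m)%:S) = 0) ->
  (forall r, (phi (HT r) + 1) * (phi (HT r) - q%:S) = 0) ->
  (forall r s : 'I_n.-1, s = r.+1 :> nat -> phi (HT r) * phi (HT s) * phi (HT r) =
                                   phi (HT s) * phi (HT r) * phi (HT s)) ->
  (forall k m, phi (HL k) * phi (HL m) = phi (HL m) * phi (HL k)) ->
  (forall r, phi (HT r) * phi (HL (lo r)) =
             phi (HL (hi r)) * (phi (HT r) - q%:S + 1)) ->
  (forall r k, k != lo r -> k != hi r ->
     phi (HT r) * phi (HL k) = phi (HL k) * phi (HT r)) ->
  (forall r s : 'I_n.-1, (r.+1 < s)%N || (s.+1 < r)%N ->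
     phi (HT r) * phi (HT s) = phi (HT s) * phi (HT r)) ->
  forall x y, hecke_rel q Q x y -> free_eval idfun phi x = free_eval idfun phi y.
Proof.
move=> cyc quad braid LL TL TLf TT x y.
case=> [k k0|r|r s rs|k m|r|r k kl kh|r s rs].
- rewrite free_eval0 -(cyc k k0) rmorph_prod; apply: eq_bigr => m _ /=.
  by rewrite free_evalD free_evalN free_eval_gen free_eval_scal.
- by rewrite !free_evalE quad.
- by rewrite !free_evalM !free_eval_gen braid.
- by rewrite !free_evalM !free_eval_gen LL.
- by rewrite !free_evalE TL.
- by rewrite !free_evalM !free_eval_gen TLf.
- by rewrite !free_evalM !free_eval_gen TT.
Qed.

End HeckeRelations.

Section Character.
Variables (R : comNzRingType) (l n : nat) (q : R) (Q : 'I_l -> R) (j : 'I_l).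
Variables (u t : R).
Hypotheses (tq : (t + 1) * (t - q) = 0) (tu : t = u * (t - q + 1)).

(** The modules of the one-row multipartitions are the case t = u = q, those of
    the one-column multipartitions t = -1 and u = q^-1. *)
Definition char_gen (g : hecke_index n) : R^o :=
  match g with HL k => Q j * u ^+ k | HT _ => t end.

Lemma char_rel x y : hecke_rel q Q x y ->
  free_eval idfun char_gen x = free_eval idfun char_gen y.
Proof.
apply: hecke_relP => [k k0|//|//|k m|r|r k _ _|//]; try exact: mulrC.
  by rewrite (bigD1 j) //= k0 expr0 mulr1 [X in X * _]subrr mul0r.
change (t * (Q j * u ^+ r) = Q j * u ^+ r.+1 * (t - q + 1) :> R).
by rewrite exprS {1}tu; ring.
Qed.
End Character.

Section TwoDim.
Variables (R : comUnitRingType) (l : nat) (q : R) (Q : 'I_l -> R) (m m' : 'I_l).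
Hypothesis mm' : m' != m.

Definition mx2 (a b c d : R) : 'M[R]_2 :=
  \matrix_(i, j) if i == ord0 then (if j == ord0 then a else b)
                 else (if j == ord0 then c else d).

Lemma mx2M a b c d a' b' c' d' : mx2 a b c d * mx2 a' b' c' d' =
  mx2 (a * a' + b * c') (a * b' + b * d') (c * a' + d * c') (c * b' + d * d').
Proof.
apply/matrixP=> i j; rewrite !mxE !big_ord_recl big_ord0 !mxE addr0.
by case: (I2P i) => ->; case: (I2P j) => ->.
Qed.

Lemma mx2D a b c d a' b' c' d' :
  mx2 a b c d + mx2 a' b' c' d' = mx2 (a + a') (b + b') (c + c') (d + d').
Proof.
by apply/matrixP=> i j; rewrite !mxE; case: (I2P i) => ->; case: (I2P j) => ->.
Qed.

Lemma mx2N a b c d : - mx2 a b c d = mx2 (- a) (- b) (- c) (- d).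
Proof.
by apply/matrixP=> i j; rewrite !mxE; case: (I2P i) => ->; case: (I2P j) => ->.
Qed.

Lemma mx2S (a : R) : a%:S = mx2 a 0 0 a.
Proof.
by apply/matrixP=> i j; rewrite !mxE; case: (I2P i) => ->; case: (I2P j) => ->.
Qed.

Lemma mx21 : 1 = mx2 1 0 0 1.
Proof. by rewrite -mx2S rmorph1. Qed.

Lemma mx20 : 0 = mx2 0 0 0 0.
Proof. by rewrite -mx2S rmorph0. Qed.

Definition mx2E := (mx2S, mx21, mx20, mx2M, mx2D, mx2N).

(** Right multiplication on the basis v, v T of the module generated by a vector
    v of weight (Q m, Q m'); this basis needs no denominators. *)
Definition two_dim_gen (g : hecke_index 2) : 'M[R]_2 :=
  match g with
  | HL k => if k == ord0 then mx2 (Q m) 0 (- ((q - 1) * Q m')) (Q m')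
            else mx2 (Q m') 0 ((q - 1) * Q m') (Q m)
  | HT _ => mx2 0 1 q (q - 1)
  end.

Lemma two_dim_rel x y : hecke_rel q Q x y ->
  free_eval idfun two_dim_gen x = free_eval idfun two_dim_gen y.
Proof.
have i0 (r : 'I_2.-1) : r = ord0 by case: r => -[|//] ?; apply: val_inj.
apply: hecke_relP => [k k0|r|r s|k s|r|r k|r s].
- rewrite (_ : k = ord0); last exact: val_inj.
  rewrite (@prod_rem R _ _ Q _ _ m') ?mem_index_enum //.
  rewrite (@prod_rem R _ _ Q _ _ m); last first.
    by rewrite mem_rem_uniq ?index_enum_uniq // inE eq_sym mm' mem_index_enum.
  rewrite -mulrA [X in _ * X](_ : _ = 0) ?mulr0 //=.
  by rewrite !mx2E; congr mx2; ring.
- by rewrite !mx2E; congr mx2; ring.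
- by rewrite (i0 r) (i0 s).
- by case: (I2P k) => ->; case: (I2P s) => -> //=; rewrite !mx2E; congr mx2; ring.
- by rewrite (i0 r) lo_I2 hi_I2 /= !mx2E; congr mx2; ring.
- by rewrite (i0 r) lo_I2 hi_I2; case: (I2P k) => ->; rewrite eqxx.
- by rewrite (i0 r) (i0 s).
Qed.

End TwoDim.

(** * Absence of torsion in the rank-two Hecke algebra *)

Definition distinct_components (l : nat) (m : 'I_l) (c : option 'I_l) : bool :=
  if c is Some m' then m' != m else false.

(** Every weight occurs in a module, and there the coefficients of an element of
    v H_2 can be read off; V plays the role of v. For two distinct components
    v and v T are independent, otherwise v T is a multiple of v. *)
Lemma weight_rep (R : comUnitRingType) (l : nat) (q : R) (Q : 'I_l -> R) m c :
  q \is a GRing.unit ->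
  exists (B : pzAlgType R) (rho : {rmorphism hecke_alg 2 q Q -> B}) (V : B),
  [/\ forall a, rho a%:S = a%:S,
      V * rho (hecke_gen q Q (HL ord0)) = (Q m)%:S * V,
      V * rho (hecke_gen q Q (HL ord_max)) = (second_weight q Q m c)%:S * V &
      if distinct_components m c
      then forall a b, a%:S * V + b%:S * (V * rho (hecke_gen q Q (HT (ord0 : 'I_2.-1)))) = 0 ->
         a = 0 /\ b = 0
      else forall a, a%:S * V = 0 -> a = 0].
Proof.
move=> qU; have [sw|nsw] := boolP (distinct_components m c).
  case: c sw => // m' mm'.
  pose rho := lift_morphism (two_dim_rel (q := q) (Q := Q) mm').
  exists 'M[R]_2, rho, (mx2 1 0 0 0); split.
  - by move=> a; rewrite lift_morphismE plift_scal //; exact: two_dim_rel.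
  - rewrite lift_morphismE plift_gen; last exact: two_dim_rel.
    by rewrite /= !mx2E; congr mx2; ring.
  - rewrite lift_morphismE plift_gen; last exact: two_dim_rel.
    by rewrite /= (negPf mm') !mx2E; congr mx2; ring.
  - rewrite lift_morphismE plift_gen; last exact: two_dim_rel.
    move=> a b; rewrite /= !mx2E => /matrixP E.
    have := E ord0 ord0; have := E ord0 ord_max.
    by rewrite !mxE /= !(mulr0, mulr1, mul0r, addr0, add0r).
have [u [t [tq tu wE]]] : exists u t, [/\ (t + 1) * (t - q) = 0,
    t = u * (t - q + 1) & second_weight q Q m c = Q m * u].
  case: c nsw => [m'|] /=.
    move/negPn/eqP => ->; exists q, q; split; rewrite ?eqxx; ring.
  move=> _; exists q^-1, (-1); split; [ring| |exact: mulrC].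
  by rewrite addrAC addNr add0r mulrN mulVr.
pose rho := lift_morphism (char_rel (n := 2) (Q := Q) m tq tu).
exists R^o, rho, 1; rewrite /rho; split.
- by move=> a; rewrite lift_morphismE plift_scal //; exact: char_rel.
- rewrite lift_morphismE plift_gen; last exact: char_rel.
  by rewrite mul1r mulr1 /= expr0 mulr1.
- rewrite lift_morphismE plift_gen; last exact: char_rel.
  by rewrite mul1r mulr1 wE /= expr1.
- by move=> a; rewrite mulr1.
Qed.

Lemma push_span (R S : comUnitRingType) (sigma : {rmorphism R -> S})
    (A : pzAlgType R) (B : pzAlgType S) (f : {rmorphism A -> B}) (v T : A) (V : B) a b :
  (forall c, f c%:S = (sigma c)%:S) -> V * f v = V ->
  V * f (a%:S * v + b%:S * (v * T)) =
    (sigma a)%:S * V + (sigma b)%:S * (V * f T).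
Proof.
move=> fS Vv.
by rewrite rmorphD !rmorphM !fS mulrDr !(scalCA V) (mulrA V) Vv.
Qed.

Lemma span_collapse (R : comUnitRingType) (A : pzAlgType R) (v T : A) (a b t : R) :
  v * T = t%:S * v ->
  a%:S * v + b%:S * (v * T) = (a + b * t)%:S * v + 0%:S * (v * T).
Proof.
by move=> ->; rewrite rmorph0 mul0r addr0 rmorphD mulrDl rmorphM -mulrA.
Qed.

Lemma push_eigen (R S : comUnitRingType) (sigma : {rmorphism R -> S})
    (A : pzAlgType R) (B : pzAlgType S) (f : {rmorphism A -> B}) (x v : A) a :
  (forall c, f c%:S = (sigma c)%:S) -> x * v = a%:S * v ->
  f x * f v = (sigma a)%:S * f v.
Proof. by move=> fS xv; rewrite -rmorphM xv rmorphM fS. Qed.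

Section SpectralProduct.
Variables (K : fieldType) (B : pzAlgType K) (N : nat) (L : 'I_N -> B).
Variables (J : finType) (G : J -> B) (w : J -> 'I_N -> K).
Hypothesis G1 : \sum_i G i = 1.
Hypothesis LG : forall i k, L k * G i = (w i k)%:S * G i.
Variables (T : finType) (P : pred T) (ct : T -> 'I_N -> K) (s : T) (i0 : J).
Hypothesis s_i0 : forall k, ct s k = w i0 k.
Hypothesis sep : forall i, i != i0 ->
  exists k t, [/\ P t, ct t k = w i k & ct t k != ct s k].

(** Each factor acts on each G i by a scalar, so the multiplicities of the
    factors do not matter: on G i0 all of them are 1, and on any other G i the
    factor of a separating t is 0. *)
Lemma spectral_product :
  \prod_(k < N) \prod_(t | P t && (ct t k != ct s k))
     (((ct s k - ct t k)^-1)%:S * (L k - (ct t k)%:S)) = G i0.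
Proof.
set X := \prod_k _.
have XG i : X * G i = (\prod_k \prod_(t | P t && (ct t k != ct s k))
    ((ct s k - ct t k)^-1 * (w i k - ct t k)))%:S * G i.
  apply: prod_actl => k _; apply: prod_actl => t _.
  by rewrite -mulrA mulrBl LG -mulrBl -rmorphB mulrA -rmorphM.
rewrite -[LHS]mulr1 -G1 mulr_sumr (bigD1 i0) //= big1 ?addr0.
  rewrite XG big1 ?rmorph1 ?mul1r // => k _; rewrite big1 // => t /andP[_ ts].
  by rewrite -s_i0 mulVf // subr_eq0 eq_sym.
move=> i /sep[k [t [Pt tk ts]]]; rewrite XG (bigD1 k) //= (bigD1 t) /= ?Pt //.
by rewrite tk subrr mulr0 !mul0r rmorph0 mul0r.
Qed.

End SpectralProduct.

Section Injective.
Variables (R S : comUnitRingType) (sigma : {rmorphism R -> S}).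
Hypothesis sigma_inj : injective sigma.
Variables (l : nat) (q : R) (Q : 'I_l -> R) (q' : S) (Q' : 'I_l -> S).
Hypothesis (qE : sigma q = q') (QE : forall m, sigma (Q m) = Q' m).
Hypothesis qU : q \is a GRing.unit.
Hypothesis pU : q - 1 \is a GRing.unit.
Hypothesis QU : forall m, Q m \is a GRing.unit.
Hypothesis QQU : forall m m', m != m' -> Q m - Q m' \is a GRing.unit.
Hypothesis wU : forall m c d, c != d ->
  second_weight q Q m c - second_weight q Q m d \is a GRing.unit.
Hypothesis tU : forall m c, ~~ distinct_components m c ->
  forall m', second_weight q Q m c - Q m' \is a GRing.unit.

Local Notation H := (hecke_alg 2 q Q).
Local Notation H' := (hecke_alg 2 q' Q').
Variable Phi : {rmorphism H -> H'}.
Hypothesis PhiS : forall a, Phi a%:S = (sigma a)%:S.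
Hypothesis PhiG : forall g, Phi (hecke_gen q Q g) = hecke_gen q' Q' g.

Lemma second_weight_map m c :
  sigma (second_weight q Q m c) = second_weight q' Q' m c.
Proof.
case: c => [m'|] /=; last by rewrite rmorphM rmorphV // qE QE.
by case: ifP; rewrite ?rmorphM ?QE ?qE.
Qed.

Local Notation L1 := (hecke_gen q Q (HL ord0)).
Local Notation L2 := (hecke_gen q Q (HL ord_max)).
Local Notation T := (hecke_gen q Q (HT (ord0 : 'I_2.-1))).

Let rel u v (uv : hecke_rel q Q u v) :
  free_eval idfun (@hecke_gen R l 2 q Q) u = free_eval idfun (@hecke_gen R l 2 q Q) v.
Proof. exact: pgen_rel. Qed.

Lemma right_span_all (v : H) s1 s2 (x : H) :
  v * L1 = s1%:S * v -> v * L2 = s2%:S * v -> right_span T v x.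
Proof.
move=> v1 v2; have [quad TL] := (rank2_quad rel, rank2_TL rel).
elim/presented_ind: x => [|x y ? ?|a x ?|x [k|r] ?].
- exact: right_span1.
- exact: right_spanD.
- exact: right_spanZ.
- rewrite -[pgen _ _]/(hecke_gen q Q _); case: (I2P k) => ->.
    exact: (right_spanL1 TL (erefl (q - 1)) v1 v2).
  exact: (right_spanL2 quad TL qU (erefl (q - 1)) v1 v2).
- have -> : r = ord0 by case: r => -[|//] ?; apply: val_inj.
  rewrite -[pgen _ _]/(hecke_gen q Q _).
  exact: (right_spanT quad (erefl (q - 1))).
Qed.

Lemma hecke2_projectors : exists E : 'I_l -> option 'I_l -> H,
  [/\ \sum_m \sum_c E m c = 1,
      forall m c, L1 * E m c = (Q m)%:S * E m c,
      forall m c, L2 * E m c = (second_weight q Q m c)%:S * E m c,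
      forall m c, GRing.comm L1 (E m c) & forall m c, GRing.comm L2 (E m c)].
Proof.
exact: (joint_projectors (rank2_cyc rel) (rank2_quad rel) (rank2_LL rel)
  (rank2_TL rel) qU (erefl (q - 1))).
Qed.

Lemma weight_T m c : ~~ distinct_components m c ->
  exists t, t * second_weight q Q m c = (q - 1) * second_weight q Q m c + t * Q m.
Proof.
case: c => [m'|] /=.
  by move/negPn/eqP => ->; exists q; rewrite eqxx; ring.
move=> _; exists (-1); have qV : q * (q^-1 * Q m) = Q m by rewrite mulrA mulrV // mul1r.
by ring: qV.
Qed.

(** E x is a combination of E and E T for each weight projector E, and the
    coefficients vanish because they vanish after base change, in a module
    containing the weight of E. *)
Theorem base_change_inj x : Phi x = 0 -> x = 0.
Proof.
move=> Px; have [E [E1 EL1 EL2 EC1 EC2]] := hecke2_projectors.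
have ER1 m c : E m c * L1 = (Q m)%:S * E m c.
  by rewrite -EC1 EL1.
have ER2 m c : E m c * L2 = (second_weight q Q m c)%:S * E m c.
  by rewrite -EC2 EL2.
rewrite -[x]mul1r -E1 mulr_suml big1 // => m _.
rewrite mulr_suml big1 // => c _.
have qU' : q' \is a GRing.unit by rewrite -qE rmorph_unit.
have [B [rho [V [rS V1 V2 Vi]]]] := weight_rep Q' m c qU'.
pose psi : {rmorphism H -> B} := rho \o Phi.
have psiS a : psi a%:S = (sigma a)%:S by rewrite /= PhiS rS.
have psi1 : V * psi L1 = (sigma (Q m))%:S * V by rewrite /= PhiG V1 QE.
have psi2 : V * psi L2 = (sigma (second_weight q Q m c))%:S * V.
  by rewrite /= PhiG V2 second_weight_map.
have PhiT : rho (Phi T) = rho (hecke_gen q' Q' (HT (ord0 : 'I_2.-1))).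
  by rewrite PhiG.
have Vorth (a b : R) (y : H) z : V * psi y = (sigma a)%:S * V ->
    y * z = b%:S * z -> a - b \is a GRing.unit -> V * psi z = 0.
  move=> Vx xz ab; apply: (scalKu (rmorph_unit sigma ab)).
  rewrite !rmorphB mulrBl mulrA -Vx -mulrA -rmorphM xz rmorphM psiS.
  by rewrite scalCA subrr.
have VE : V * psi (E m c) = V.
  rewrite -[RHS]mulr1 -(rmorph1 psi) -E1 rmorph_sum mulr_sumr (bigD1 m) //.
  rewrite rmorph_sum mulr_sumr (bigD1 c) // !big1.
  - by rewrite /= !addr0.
  - move=> m' mm'; rewrite rmorph_sum mulr_sumr big1 // => d _.
    by apply: (Vorth _ _ _ _ psi1 (EL1 m' d)); apply: QQU; rewrite eq_sym.
  - move=> d cd.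
    by apply: (Vorth _ _ _ _ psi2 (EL2 m d)); apply: wU; rewrite eq_sym.
have sc0 a : sigma a = 0 -> a = 0.
  by move=> a0; apply: sigma_inj; rewrite rmorph0.
have [a [b ab]] := right_span_all x (ER1 m c) (ER2 m c).
have V0 : V * psi (E m c * x) = 0 by rewrite /= rmorphM Px mulr0 rmorph0 mulr0.
have [sw|nsw] := boolP (distinct_components m c); rewrite ?sw ?(negPf nsw) in Vi.
  move: V0; rewrite ab (push_span _ _ _ psiS VE) [psi T]PhiT.
  by move/Vi => [/sc0 -> /sc0 ->]; rewrite rmorph0 !mul0r addr0.
have [t tE] := weight_T nsw.
have ET := eigen_Tr (rank2_cyc rel) (rank2_TL rel) (erefl (q - 1)) (ER1 m c)
  (ER2 m c) tE (tU nsw).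
move: V0; rewrite ab (span_collapse _ _ ET) (push_span _ _ _ psiS VE) !rmorph0 mul0r addr0.
by move/Vi/sc0 => ->; rewrite (rmorph0 (scal : R -> H)) !mul0r addr0.
Qed.

(** The same projectors seen in two base changes at once, to carry an identity
    from the first to the second. *)
Lemma pushed_projectors (S1 : comUnitRingType) (res : {rmorphism R -> S1})
    (B : pzAlgType S1) (pi : {rmorphism H -> B}) (gB : hecke_index 2 -> B)
    (a : 'I_l -> S1) (b : 'I_l -> option 'I_l -> S1) :
  (forall a, pi a%:S = (res a)%:S) ->
  (forall g, pi (hecke_gen q Q g) = gB g) ->
  (forall m, res (Q m) = a m) ->
  (forall m c, res (second_weight q Q m c) = b m c) ->
  exists E : 'I_l -> option 'I_l -> H,
  [/\ \sum_m \sum_c Phi (E m c) = 1,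
      forall m c, hecke_gen q' Q' (HL ord0) * Phi (E m c) = (Q' m)%:S * Phi (E m c) &
      forall m c, hecke_gen q' Q' (HL ord_max) * Phi (E m c) =
                  (second_weight q' Q' m c)%:S * Phi (E m c)] /\
  [/\ \sum_m \sum_c pi (E m c) = 1,
      forall m c, gB (HL ord0) * pi (E m c) = (a m)%:S * pi (E m c),
      forall m c, gB (HL ord_max) * pi (E m c) = (b m c)%:S * pi (E m c),
      forall m c, GRing.comm (gB (HL ord0)) (pi (E m c)) &
      forall m c, GRing.comm (gB (HL ord_max)) (pi (E m c))].
Proof.
move=> piS piG Qa wb; have [E [E1 EL1 EL2 EC1 EC2]] := hecke2_projectors.
have sumE (X : pzRingType) (f : {rmorphism H -> X}) : \sum_m \sum_c f (E m c) = 1.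
  by rewrite -(rmorph1 f) -E1 rmorph_sum; apply: eq_bigr => m _; rewrite rmorph_sum.
exists E; split; split; try exact: sumE; move=> m c.
- by rewrite -PhiG -QE; exact: push_eigen PhiS (EL1 m c).
- by rewrite -PhiG -second_weight_map; exact: push_eigen PhiS (EL2 m c).
- by rewrite -piG -Qa; exact: push_eigen piS (EL1 m c).
- by rewrite -piG -wb; exact: push_eigen piS (EL2 m c).
- by rewrite /GRing.comm -piG -!rmorphM EC1.
- by rewrite /GRing.comm -piG -!rmorphM EC2.
Qed.

End Injective.

(** * Residues and standard tableaux *)

Section Powers.
Variables (F : fieldType) (e : nat) (q : F).
Hypotheses (e_gt1 : (1 < e)%N) (q_prim : e.-primitive_root q).

Lemma qpow_inj (a b : 'Z_e) : q ^+ a = q ^+ b -> a = b.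
Proof.
have lt (c : 'Z_e) : (c < e)%N by have := ltn_ord c; rewrite {2}(Zp_cast e_gt1).
move/eqP; rewrite (eq_prim_root_expr q_prim) !modn_small // => /eqP ab.
exact: val_inj.
Qed.

Lemma qpowD (a b : 'Z_e) : q ^+ (a + b : 'Z_e)%R = q ^+ a * q ^+ b.
Proof.
rewrite -exprD -[in RHS](expr_mod _ (prim_expr_order q_prim)).
by rewrite /= {3}(Zp_cast e_gt1).
Qed.

End Powers.

Section Residues.
Variables (e l : nat) (kap : 'I_l -> 'Z_e).
Hypotheses (e_gt1 : (1 < e)%N) (l_gt1 : (1 < l)%N).
Hypothesis adj : forall a b : 'I_l, a != b ->
  [/\ kap a - kap b != 0, kap a - kap b != 1 & kap a - kap b != -1].

(** For e = 2 any two distinct residues are adjacent. *)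
Lemma two_neq0 : (1 + 1 : 'Z_e) != 0.
Proof.
apply/eqP=> h; have := val_Zp_nat e_gt1 2; rewrite mulr2n h /=.
move/esym/eqP; rewrite -/(dvdn e 2) => /dvdn_leq -/(_ isT) e2.
have {}e2 : e = 2%N by apply/eqP; rewrite eqn_leq e2.
case: l l_gt1 kap adj => [|[|l']] // _ k /(_ ord0 (lift ord0 ord0) isT).
move: (k ord0 - k (lift ord0 ord0)) => x [].
subst e; by case: x => -[|[|//]].
Qed.

Definition second_residue (m : 'I_l) (c : option 'I_l) : 'Z_e :=
  if c is Some m' then if m' == m then kap m + 1 else kap m' else kap m - 1.

Lemma kap_inj : injective kap.
Proof.
move=> a b ab; apply/eqP; apply: contraT => /adj[].
by rewrite ab subrr eqxx.
Qed.

(** Adjacency-freeness; this makes v T proportional to v for rows and columns. *)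
Lemma second_residue_kap m c m' : ~~ distinct_components m c -> second_residue m c != kap m'.
Proof.
have n1 : (1 : 'Z_e) != 0 by rewrite oner_eq0.
case: c => [a|] /=.
  move/negPn/eqP => ->; rewrite eqxx; apply/eqP => h.
  have [mm'|/adj[_ _]] := eqVneq m m'.
    by move/eqP: h; rewrite mm' -subr_eq0 addrAC subrr add0r (negPf n1).
  by rewrite -h opprD addNKr eqxx.
move=> _; apply/eqP => h; have [mm'|/adj[_]] := eqVneq m m'.
  by move/eqP: h; rewrite mm' -subr_eq0 addrAC subrr add0r oppr_eq0 (negPf n1).
by rewrite -h subKr eqxx.
Qed.

Lemma second_residue_inj m : injective (second_residue m).
Proof.
have swE m' : distinct_components m (Some m') -> second_residue m (Some m') = kap m'.
  by move=> /= /negPf->.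
move=> c d; have [sc|nc] := boolP (distinct_components m c); have [sd|nd] := boolP (distinct_components m d).
- by case: c d sc sd => [c|] // [d|] // /swE-> /swE-> /kap_inj->.
- by case: c sc => [c|] // /swE-> h; have := second_residue_kap c nd; rewrite -h eqxx.
- by case: d sd => [d|] // /swE-> h; have := second_residue_kap d nc; rewrite -h eqxx.
case: c d nc nd => [c|] [d|] //=.
- by move=> /negPn/eqP-> /negPn/eqP->.
- move=> /negPn/eqP-> _; rewrite eqxx => /addrI h.
  by have := two_neq0; rewrite {1}h addNr eqxx.
- move=> _ /negPn/eqP->; rewrite eqxx => /addrI h.
  by have := two_neq0; rewrite -{1}h addNr eqxx.
Qed.

End Residues.

Lemma kappa_adj (e l n : nat) (khat : 'I_l -> int) :
  strongly_adjacency_free e n khat -> forall a b : 'I_l, a != b ->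
  [/\ kappa e khat a - kappa e khat b != 0, kappa e khat a - kappa e khat b != 1 &
      kappa e khat a - kappa e khat b != -1].
Proof. by case. Qed.

Lemma I2_lt1 (c : 'I_2) : (c < 1)%N -> c = ord0.
Proof. by case: (I2P c) => ->. Qed.

Section Tableaux.
Variables (l : nat) (m : 'I_l).

Definition second_node (c : option 'I_l) : node 2 l :=
  if c is Some m' then if m' == m then (ord0, ord_max, m) else (ord0, ord0, m')
  else (ord_max, ord0, m).

(** The standard tableau with weight (Q m, second_weight m c). *)
Definition weight_tableau (c : option 'I_l) : tableau 2 l :=
  [ffun k => if k == ord0 then (ord0, ord0, m) else second_node c].

Lemma column_Std : weight_tableau None \in Std 2 l.
Proof.
rewrite inE; apply/existsP.
exists [ffun a => [ffun r => inord (a == m)]].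
have lE (b : bool) : (inord b : 'I_3) = b :> nat by rewrite inordK; case: b.
apply/andP; split; [apply/andP; split|apply/and3P; split].
- apply/forallP=> a; apply/forallP=> r; apply/forallP=> s; apply/implyP=> _.
  by rewrite !ffunE.
- rewrite (bigD1 m) //= [X in (_ + X)%N]big1 => [|a /negPf am].
    by rewrite !big_ord_recl big_ord0 !ffunE lE eqxx.
  by rewrite !big_ord_recl big_ord0 !ffunE lE am.
- by apply/injectiveP=> a b; rewrite !ffunE; case: (I2P a) => ->; case: (I2P b) => ->.
- apply/eqP/setP=> -[[r c] a]; rewrite inE /col_of /row_of /comp_of /= !ffunE lE.
  apply/imsetP/idP => [[k _]|].
    by rewrite ffunE; case: ifP => _ [_ -> ->]; rewrite eqxx.
  case: eqP => // -> c0; rewrite (I2_lt1 c0).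
  by case: (I2P r) => ->; [exists ord0|exists ord_max]; rewrite // ffunE.
- apply/forallP=> a; apply/forallP=> b; rewrite !ffunE.
  by case: (I2P a) => ->; case: (I2P b) => ->; rewrite /col_of /row_of /comp_of /= !eqxx.
Qed.

Lemma split_Std m' : m' != m -> weight_tableau (Some m') \in Std 2 l.
Proof.
move=> m'm; rewrite inE; apply/existsP.
exists [ffun a => [ffun r => inord (((a == m) || (a == m')) && (r == ord0))]].
have lE (b : bool) : (inord b : 'I_3) = b :> nat by rewrite inordK; case: b.
apply/andP; split; [apply/andP; split|apply/and3P; split].
- apply/forallP=> a; apply/forallP=> r; apply/forallP=> s; rewrite !ffunE !lE.
  by case: (I2P r) => ->; case: (I2P s) => ->; rewrite ?andbF ?leqnn ?implybT.
- rewrite (bigD1 m) // (bigD1 m') //= [X in (_ + (_ + X))%N]big1.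
    by rewrite !big_ord_recl !big_ord0 !ffunE !lE !eqxx orbT.
  move=> a /andP[/negPf am /negPf am'].
  by rewrite !big_ord_recl big_ord0 !ffunE !lE am am'.
- apply/injectiveP=> a b; rewrite !ffunE /= (negPf m'm).
  case: (I2P a) => ->; case: (I2P b) => -> //= => -[E];
  by rewrite E eqxx in m'm.
- apply/eqP/setP=> -[[r c] a]; rewrite inE /col_of /row_of /comp_of /= !ffunE lE.
  apply/imsetP/idP => [[k _]|].
    by rewrite ffunE /= (negPf m'm); case: ifP => _ [-> -> ->]; rewrite !eqxx ?orbT.
  case: eqP => [->|_]; case: (r =P ord0) => [->|_] //=; rewrite ?andbF //.
    move=> c0; rewrite (I2_lt1 c0).
    by exists ord0; rewrite // ffunE.
  rewrite andbT; case: eqP => [->|_] // c0.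
  rewrite (I2_lt1 c0).
  by exists ord_max; rewrite // ffunE /= (negPf m'm).
- apply/forallP=> a; apply/forallP=> b; rewrite !ffunE /= (negPf m'm).
  case: (I2P a) => ->; case: (I2P b) => ->; rewrite /col_of /row_of /comp_of /= ?eqxx //.
  all: by rewrite /= ?(eq_sym m) ?(negPf m'm).
Qed.

Lemma row_Std : weight_tableau (Some m) = one_row_tableau m.
Proof.
by apply/ffunP=> k; rewrite !ffunE /= eqxx; case: (I2P k) => ->.
Qed.

Lemma weight_tableau_Std c : weight_tableau c \in Std 2 l.
Proof.
case: c => [m'|]; last exact: column_Std.
have [->|] := eqVneq m' m; last exact: split_Std.
rewrite row_Std inE; apply/existsP; exists (one_row 2 m).
by rewrite one_row_multipartition one_row_tableauP eqxx.
Qed.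

End Tableaux.

(** * The seminormal idempotent over the local ring *)

Section LocalForm.
Variables (F : fieldType) (e l n : nat) (q : F) (khat : 'I_l -> int).
Hypotheses (e_gt1 : (1 < e)%N) (l_gt1 : (1 < l)%N) (n_gt1 : (1 < n)%N).
Hypothesis q_prim : e.-primitive_root q.
Hypothesis khat_adj : strongly_adjacency_free e n khat.

Local Notation O := (loc_ring q).
Local Notation K := {fraction {poly F}}.
Local Notation kap := (kappa e khat).
Let qO : O := loc_qhatX q 1.
Let QO (m : 'I_l) : O := loc_qhatX q (khat m).
Let qK : K := qhat F.
Let QK (m : 'I_l) : K := qhat F ^ khat m.

Let adj := kappa_adj khat_adj.

Let q0 : q != 0. Proof. exact: root1_neq0 e_gt1 (prim_expr_order q_prim). Qed.

Lemma res_qO : loc_res qO = q.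
Proof. by rewrite loc_res_qhatX // expr1z. Qed.

Lemma res_QO m : loc_res (QO m) = q ^+ kap m.
Proof. by rewrite loc_res_qhatX // (exprz_modZ _ e_gt1 (prim_expr_order q_prim)). Qed.

Lemma val_qO : val qO = qK.
Proof. by rewrite val_loc_qhatX // expr1z. Qed.

Lemma val_QO m : val (QO m) = QK m.
Proof. exact: val_loc_qhatX. Qed.

Lemma qO_unit : qO \is a GRing.unit.
Proof. by rewrite loc_unitE res_qO. Qed.

Lemma q_expD1 (a : 'Z_e) : q ^+ (a + 1 : 'Z_e)%R = q * q ^+ a.
Proof.
rewrite (qpowD e_gt1 q_prim) mulrC; congr (_ * _).
Qed.

Lemma loc_resM (x y : O) : loc_res (x * y) = loc_res x * loc_res y.
Proof. exact: rmorphM. Qed.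

Lemma loc_resV (x : O) : x \is a GRing.unit -> loc_res x^-1 = (loc_res x)^-1.
Proof. exact: rmorphV. Qed.

Lemma loc_resB (x y : O) : loc_res (x - y) = loc_res x - loc_res y.
Proof. exact: rmorphB. Qed.

Lemma res_second_weight m c :
  loc_res (second_weight qO QO m c) = q ^+ second_residue kap m c.
Proof.
case: c => [m'|] /=.
  case: ifP => _; last by rewrite res_QO.
  by rewrite loc_resM res_qO res_QO q_expD1.
rewrite loc_resM (loc_resV qO_unit) res_qO res_QO.
by rewrite -[in LHS](subrK 1 (kap m)) q_expD1 mulKf.
Qed.

Lemma QO_unit m : QO m \is a GRing.unit.
Proof. by rewrite loc_unitE res_QO expf_neq0. Qed.

Lemma resB (x y : O) (a b : 'Z_e) : loc_res x = q ^+ a -> loc_res y = q ^+ b ->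
  a != b -> x - y \is a GRing.unit.
Proof.
move=> xa yb; apply: contra_neqT; rewrite loc_unitE negbK loc_resB.
by rewrite xa yb subr_eq0 => /eqP/(qpow_inj e_gt1 q_prim).
Qed.

Lemma pO_unit : qO - 1 \is a GRing.unit.
Proof.
apply: (@resB _ _ 1 0); rewrite ?oner_eq0 //.
  by rewrite res_qO -[1]add0r q_expD1 mulr1.
exact: rmorph1.
Qed.

Lemma QO_sub m m' : m != m' -> QO m - QO m' \is a GRing.unit.
Proof.
move=> mm'; apply: (resB (res_QO m) (res_QO m')).
by apply: contra_neq mm' => /(kap_inj adj).
Qed.

Lemma wO_sub m c d : c != d ->
  second_weight qO QO m c - second_weight qO QO m d \is a GRing.unit.
Proof.
move=> cd; apply: (resB (res_second_weight m c) (res_second_weight m d)).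
by apply: contra_neq cd => /(second_residue_inj e_gt1 l_gt1 adj).
Qed.

Lemma wO_QO m c : ~~ distinct_components m c -> forall m',
  second_weight qO QO m c - QO m' \is a GRing.unit.
Proof.
move=> nsw m'; apply: (resB (res_second_weight m c) (res_QO m')).
exact: second_residue_kap.
Qed.

Definition hom_to_K : {rmorphism hecke_alg 2 qO QO -> hecke_alg 2 qK QK} :=
  lift_morphism (fun u v => @hecke2O_to_K_rel F l q khat u v q0).

Definition hom_to_F : {rmorphism hecke_alg 2 qO QO -> heckeF e n q khat} :=
  lift_morphism (fun u v => @hecke2O_to_F_rel F e l n n_gt1 q khat u v e_gt1
    (prim_expr_order q_prim)).

Lemma hom_to_FS (a : O) : hom_to_F a%:S = (loc_res a)%:S.
Proof. by apply: plift_scal => u v; exact: hecke2O_to_F_rel e_gt1 (prim_expr_order q_prim). Qed.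

Lemma hom_to_FG g : hom_to_F (hecke_gen qO QO g) = h2_gen e n_gt1 q khat g.
Proof. by apply: plift_gen => u v; exact: hecke2O_to_F_rel e_gt1 (prim_expr_order q_prim). Qed.

Lemma hom_to_KS (a : O) : hom_to_K a%:S = (val a)%:S.
Proof. by apply: plift_scal => u v; exact: hecke2O_to_K_rel. Qed.

Lemma hom_to_KG g : hom_to_K (hecke_gen qO QO g) = hecke_gen qK QK g.
Proof. by apply: plift_gen => u v; exact: hecke2O_to_K_rel. Qed.

Lemma hom_to_FE (x : hecke2O q khat) : hom_to_F x = hecke2O_to_F e n_gt1 x.
Proof. by []. Qed.

(** The form over O is torsion-free, so the preimage of the seminormal
    element is unique. *)
Lemma hom_to_K_inj : injective hom_to_K.
Proof.
apply: raddf_inj => x.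
exact: (base_change_inj val_inj val_qO val_QO
  qO_unit pO_unit QO_unit QO_sub wO_sub wO_QO hom_to_KS hom_to_KG).
Qed.

Lemma qK_neq0 : qK != 0.
Proof. by rewrite tofrac_eq0 polyX_eq0. Qed.

Lemma contentK_weight m c (k : 'I_2) :
  contentK F khat (weight_tableau m c) k =
  if k == ord0 then QK m else second_weight qK QK m c.
Proof.
rewrite /contentK ffunE; case: (I2P k) => -> /=; first by rewrite addr0 subr0.
case: c => [m'|] /=; last by rewrite addr0 expfzDr ?qK_neq0 // mulrC.
have [_|_] /= := eqVneq m' m; last by rewrite addr0 subr0.
by rewrite subr0 expfzDr ?qK_neq0 // mulrC.
Qed.

Lemma QK_neq m m' : m != m' -> QK m != QK m'.
Proof.
move=> /QO_sub; apply: contraTneq; rewrite -!val_QO => /val_inj->.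
by rewrite subrr unitr0.
Qed.

Lemma wK_neq m c d : c != d -> second_weight qK QK m c != second_weight qK QK m d.
Proof.
have sw := second_weight_map val_qO val_QO qO_unit.
move=> /(wO_sub m); apply: contraTneq; rewrite -!sw => /val_inj->.
by rewrite subrr unitr0.
Qed.

(** Each weight differs from that of the row in one of its two contents, and
    the standard tableau of that weight supplies the factor that kills it. *)
Lemma seminormal_projector (E : 'I_l -> option 'I_l -> heckeK F 2 khat) (j : 'I_l) :
  \sum_m \sum_c E m c = 1 ->
  (forall m c, heckeK_gen F khat (HL ord0) * E m c = (QK m)%:S * E m c) ->
  (forall m c, heckeK_gen F khat (HL ord_max) * E m c =
               (second_weight qK QK m c)%:S * E m c) ->
  seminormal_idem F khat (one_row_tableau j) = E j (Some j).
Proof.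
move=> E1 EL1 EL2; set s := one_row_tableau j.
pose w (i : 'I_l * option 'I_l) (k : 'I_2) :=
  if k == ord0 then QK i.1 else second_weight qK QK i.1 i.2.
have sE k : contentK F khat s k = w (j, Some j) k by rewrite /s -row_Std contentK_weight.
apply: (@spectral_product K (heckeK F 2 khat) 2 (fun k => heckeK_gen F khat (HL k)) _
  (fun i : 'I_l * option 'I_l => E i.1 i.2) w _ _ _ _ _ s (j, Some j)).
- by rewrite -E1 pair_big.
- by move=> [m c] k; rewrite /w; case: (I2P k) => -> /=.
- exact: sE.
move=> [m c] mc.
suff [k k0] : exists k, w (m, c) k != w (j, Some j) k.
  exists k, (weight_tableau m c); split; first exact: weight_tableau_Std.
    by rewrite contentK_weight.
  by rewrite contentK_weight sE.
have [mj|mj] := eqVneq m j; last by exists ord0; exact: QK_neq.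
exists ord_max; rewrite mj; apply: (@wK_neq j c (Some j)).
by move: mc; rewrite mj xpair_eqE eqxx.
Qed.

Definition O_projectors := pushed_projectors val_qO val_QO
  qO_unit pO_unit QO_unit QO_sub wO_sub hom_to_KS hom_to_KG hom_to_FS hom_to_FG
  res_QO res_second_weight.

Lemma row_element (j : 'I_l) : exists x : hecke2O q khat,
  hecke2O_to_K x = seminormal_idem F khat (one_row_tableau j).
Proof.
have [E [[K1 KL1 KL2] _]] := O_projectors.
exists (E j (Some j)); exact: esym (seminormal_projector j K1 KL1 KL2).
Qed.

Lemma hecke_projectors (j : 'I_l) (x : hecke2O q khat) :
  hecke2O_to_K x = seminormal_idem F khat (one_row_tableau j) ->
  exists E : 'I_l -> option 'I_l -> heckeF e n q khat,
  [/\ \sum_m \sum_c E m c = 1,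
      forall m c, h2_gen e n_gt1 q khat (HL ord0) * E m c = (q ^+ kap m)%:S * E m c,
      forall m c, h2_gen e n_gt1 q khat (HL ord_max) * E m c =
         (q ^+ second_residue kap m c)%:S * E m c,
      forall m c, GRing.comm (h2_gen e n_gt1 q khat (HL ord0)) (E m c) &
      forall m c, GRing.comm (h2_gen e n_gt1 q khat (HL ord_max)) (E m c)] /\
  hecke2O_to_F e n_gt1 x = E j (Some j).
Proof.
have [E [[K1 KL1 KL2] FE]] := O_projectors.
move=> xK; have xE : x = E j (Some j) :=
  hom_to_K_inj (etrans xK (seminormal_projector j K1 KL1 KL2)).
exists (fun m c => hom_to_F (E m c)); split; first exact: FE.
by rewrite xE.
Qed.
End LocalForm.

(** * Weight idempotents of the KLR algebra *)

Section WeightSum.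
Variables (F : fieldType) (A : pzAlgType F).

(** L - a acts on x, hence on x p, by the invertible scalar b - a. *)
Lemma eigen_gen_orth (L x p : A) a b N : GRing.comm L x -> L * x = b%:S * x ->
  (L - a%:S) ^+ N * p = 0 -> b != a -> x * p = 0.
Proof.
move=> Lx bx ap ba; have La c : GRing.comm (L - c%:S) x.
  by apply/commr_sym/commrB; [exact: commr_sym|exact/esym/scalC].
have pow k : (L - a%:S) ^+ k * x = ((b - a) ^+ k)%:S * x.
  elim: k => [|k IHk]; first by rewrite !expr0 rmorph1.
  rewrite exprSr -mulrA mulrBl bx -mulrBl -rmorphB scalCA IHk.
  by rewrite mulrA -rmorphM -exprS.
have uN : (b - a) ^+ N \is a GRing.unit.
  by rewrite unitfE expf_neq0 // subr_eq0.
apply: (scalKu uN); rewrite mulrA -pow.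
rewrite (_ : (L - a%:S) ^+ N * x = x * (L - a%:S) ^+ N); last first.
  by apply/esym/commrX/commr_sym/La.
by rewrite -mulrA ap mulr0.
Qed.

Variables (J W : finType) (D : eqType) (G : J -> A) (p : W -> A) (L1 L2 : A).
Variables (r1 r2 : J -> D) (i1 i2 : W -> D) (qp : D -> F).
Hypothesis qp_inj : injective qp.
Hypotheses (G1 : \sum_s G s = 1) (p1 : \sum_i p i = 1).
Hypothesis LG1 : forall s, L1 * G s = (qp (r1 s))%:S * G s.
Hypothesis LG2 : forall s, L2 * G s = (qp (r2 s))%:S * G s.
Hypothesis CG1 : forall s, GRing.comm L1 (G s).
Hypothesis CG2 : forall s, GRing.comm L2 (G s).
Hypothesis Lp1 : forall i, exists N, (L1 - (qp (i1 i))%:S) ^+ N * p i = 0.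
Hypothesis Lp2 : forall i, exists N, (L2 - (qp (i2 i))%:S) ^+ N * p i = 0.

Lemma projector_weight_orth s i :
  (r1 s != i1 i) || (r2 s != i2 i) -> G s * p i = 0.
Proof.
case/orP=> ri.
  have [N Np] := Lp1 i; apply: eigen_gen_orth (CG1 s) (LG1 s) Np _.
  by rewrite (inj_eq qp_inj).
have [N Np] := Lp2 i; apply: eigen_gen_orth (CG2 s) (LG2 s) Np _.
by rewrite (inj_eq qp_inj).
Qed.

(** Two resolutions of 1 by weights, where only the G s are known to commute
    with L1 and L2: then G s p i = 0 unless the weights of s and i agree, so G s0
    kills p i or fixes it. *)
Lemma projector_weight_sum s0 :
  (forall s, r1 s = r1 s0 -> r2 s = r2 s0 -> s = s0) ->
  G s0 = \sum_(i | (i1 i == r1 s0) && (i2 i == r2 s0)) p i.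
Proof.
move=> s0u; rewrite -[LHS]mulr1 -p1 mulr_sumr.
rewrite [RHS]big_mkcond; apply: eq_bigr => i _; case: ifP => [/andP[/eqP e1 /eqP e2]|].
  rewrite -[RHS]mul1r -G1 mulr_suml (bigD1 s0) //= big1 ?addr0 // => s ss0.
  apply: projector_weight_orth; rewrite -negb_and e1 e2.
  by apply: contraNN ss0 => /andP[/eqP h1 /eqP h2]; apply/eqP/s0u.
by move/negbT; rewrite negb_and eq_sym [i2 i == _]eq_sym; exact: projector_weight_orth.
Qed.

End WeightSum.

Section WeightIdempotents.
Variables (F : fieldType) (e l n : nat) (q : F) (khat : 'I_l -> int).
Hypotheses (e_gt1 : (1 < e)%N) (l_gt1 : (1 < l)%N) (n_gt1 : (1 < n)%N).
Hypothesis q_prim : e.-primitive_root q.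
Hypothesis khat_adj : strongly_adjacency_free e n khat.
Variable f : {rmorphism klrR F e n khat -> heckeF e n q khat}.
Hypothesis f_bkr : bkr_morphism f.

Local Notation kap := (kappa e khat).
Let i0 : 'I_n := widen_ord n_gt1 ord0.
Let i1 : 'I_n := widen_ord n_gt1 ord_max.

Let good (j : 'I_l) (i : residues e n) := (i i0 == kap j) && (i i1 == kap j + 1).

Let adj := kappa_adj khat_adj.

Lemma klr_sum1 : \sum_(i : residues e n) klrR_gen F khat (E i) = 1.
Proof.
have := pgen_rel (klr_sumE F n kap); rewrite free_eval1 rmorph_sum => <-.
by apply: eq_bigr => i _; rewrite /= free_eval_gen.
Qed.

Lemma row_element_sum (j : 'I_l) (x : hecke2O q khat) :
  hecke2O_to_K x = seminormal_idem F khat (one_row_tableau j) ->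
  hecke2O_to_F e n_gt1 x = f (\sum_(i | good j i) klrR_gen F khat (E i)).
Proof.
move=> xK.
have [E0 [[E1 EL1 EL2 EC1 EC2] ->]] :=
  hecke_projectors e_gt1 l_gt1 n_gt1 q_prim khat_adj xK.
have [_ fw _] := f_bkr.
have fwk (i : residues e n) (k : 'I_n) : exists N,
    (heckeF_gen e q khat (HL k) - (q ^+ i k)%:S) ^+ N * f (klrR_gen F khat (E i)) = 0.
  by have [_ /(_ 1 k) [N]] := fw i; rewrite mulr1; exists N.
rewrite rmorph_sum.
rewrite (@projector_weight_sum F (heckeF e n q khat) _ _ _
   (fun s : 'I_l * option 'I_l => E0 s.1 s.2) (fun i => f (klrR_gen F khat (E i)))
   (h2_gen e n_gt1 q khat (HL ord0)) (h2_gen e n_gt1 q khat (HL ord_max))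
   (fun s => kap s.1) (fun s => second_residue kap s.1 s.2)
   (fun i => i i0) (fun i => i i1) (fun a : 'Z_e => q ^+ a)
   (qpow_inj e_gt1 q_prim) _ _ _ _ _ _ _ _ (j, Some j)) => //.
- by apply: eq_bigl => i; rewrite /good /= eqxx.
- by rewrite -E1 pair_big.
- by rewrite -rmorph_sum klr_sum1 rmorph1.
- by move=> i; exact: fwk.
- by move=> i; exact: fwk.
move=> [m c] /(kap_inj adj) /= -> h; congr (_, _).
exact: (@second_residue_inj e l kap e_gt1 l_gt1 adj j c (Some j) h).
Qed.

Let Q (m : 'I_l) : F := q ^+ kap m.

Lemma h2_rel u v : hecke_rel q Q u v ->
  free_eval idfun (h2_gen e n_gt1 q khat) u = free_eval idfun (h2_gen e n_gt1 q khat) v.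
Proof.
apply: (@hecke_eval_rel F F idfun l 2 q Q (heckeF e n q khat)
  (h2_gen e n_gt1 q khat) n (heckeF_gen e q khat) Q
  (widen_ord n_gt1) (widen_ord (pred2_leq n_gt1))) => // u' v'.
exact: pgen_rel.
Qed.

Lemma q_neq0 : q != 0. Proof. exact: root1_neq0 e_gt1 (prim_expr_order q_prim). Qed.

Lemma trivial_tu : q = q * (q - q + 1).
Proof. by rewrite subrr add0r mulr1. Qed.

Lemma trivial_tq : (q + 1) * (q - q) = 0.
Proof. by rewrite subrr mulr0. Qed.

(** Being defined on all of H_n, this character restricts to the subalgebra H_2,
    where a character given by a presentation would not be available. *)
Definition trivial_char (j : 'I_l) : {rmorphism heckeF e n q khat -> F^o} :=
  lift_morphism (char_rel (n := n) (Q := Q) j trivial_tq trivial_tu).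

Lemma trivial_charS j a : trivial_char j a%:S = a.
Proof. by apply: plift_scal => u v; exact: char_rel trivial_tq trivial_tu _ _. Qed.

Lemma trivial_charG j g : trivial_char j (heckeF_gen e q khat g) =
  char_gen Q j q q g.
Proof. by apply: plift_gen => u v; exact: char_rel trivial_tq trivial_tu _ _. Qed.

End WeightIdempotents.

(** * Row idempotents in the rank-two subalgebra *)

Section CharacterIdempotent.
Variables (F : fieldType) (A : pzAlgType F) (chi : {rmorphism A -> F}) (u : A).
Hypothesis yu : forall y, y * u = (chi y)%:S * u.
Hypothesis uy : forall y, u * y = (chi y)%:S * u.
Hypothesis chiu : chi u = 1.

Let uu : u * u = u. Proof. by rewrite yu chiu rmorph1 mul1r. Qed.
Let u0 : u <> 0.
Proof. by move=> u0; move: chiu; rewrite u0 rmorph0 => /eqP; rewrite eq_sym oner_eq0. Qed.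

(** The ideal generated by u is F u, so an idempotent below u is 0 or u. *)
Lemma character_idem_primitive : primitive_central_idempotent u.
Proof.
split=> //; first by split=> // a; rewrite yu uy.
move=> y z [yy yC] [zz zC] yz uE.
have yE : y = (chi y)%:S * u by rewrite -uy uE mulrDl yy -zC yz addr0.
have [c0|c0] := eqVneq (chi y) 0; first by left; rewrite yE c0 rmorph0 mul0r.
right; have c1 : chi y = 1.
  by apply: (mulfI c0); rewrite mulr1 -rmorphM yy.
by apply: (addrI y); rewrite -uE yE c1 rmorph1 mul1r addr0.
Qed.

(** x u = u exhibits u as a summand of the primitive x. *)
Lemma character_idem_unique x :
  primitive_central_idempotent x -> chi x = 1 -> x = u.
Proof.
move=> [[xx xC] x0 xprim] cx.
have xu : x * u = u by rewrite yu cx rmorph1 mul1r.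
have ux : u * x = u by rewrite uy cx rmorph1 mul1r.
have [||||//|/eqP] := xprim u (x - u).
- by split=> // a; rewrite yu uy.
- split=> [|a]; last by rewrite mulrBr mulrBl xC yu uy.
  by rewrite mulrBl !mulrBr xx xu ux uu subrr subr0.
- by rewrite mulrBr ux uu subrr.
- by rewrite addrC subrK.
by rewrite subr_eq0 => /eqP.
Qed.

End CharacterIdempotent.

Lemma character_kills (F : fieldType) (A : pzAlgType F)
    (chi : {rmorphism A -> F^o}) (x v : A) a :
  (forall b, chi b%:S = b) -> x * v = a%:S * v -> chi x != a -> chi v = 0.
Proof.
move=> chiS /(congr1 chi); rewrite !rmorphM chiS => /eqP.
rewrite -subr_eq0 -mulrBl mulf_eq0 subr_eq0 => /orP[/eqP->|/eqP//].
by rewrite eqxx.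
Qed.

Section RowProjector.
Variables (F : fieldType) (l : nat) (q : F) (Q : 'I_l -> F).
Variables (A : pzAlgType F) (L1 L2 T : A).
Hypothesis cyc : \prod_(m < l) (L1 - (Q m)%:S) = 0.
Hypothesis quad : (T + 1) * (T - q%:S) = 0.
Hypothesis TL1 : T * L1 = L2 * (T - q%:S + 1).
Hypothesis q0 : q != 0.
Variables (w : 'I_l -> option 'I_l -> F) (E : 'I_l -> option 'I_l -> A).
Hypothesis HE : [/\ \sum_m \sum_c E m c = 1,
  forall m c, L1 * E m c = (Q m)%:S * E m c,
  forall m c, L2 * E m c = (w m c)%:S * E m c,
  forall m c, GRing.comm L1 (E m c) & forall m c, GRing.comm L2 (E m c)].
Variable j : 'I_l.
Hypothesis wj : w j (Some j) = q * Q j.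
Hypothesis qQ : forall m, q * Q j != Q m.

Let X := E j (Some j).

Lemma row_projectorL1 : L1 * X = (Q j)%:S * X.
Proof. by case: HE => _ EL1 _ _ _; exact: EL1. Qed.

Lemma row_projectorL2 : L2 * X = (q * Q j)%:S * X.
Proof. by case: HE => _ _ EL2 _ _; rewrite EL2 wj. Qed.

Lemma row_projector_L1 : X * L1 = (Q j)%:S * X.
Proof. by case: HE => _ _ _ EC1 _; rewrite -EC1 row_projectorL1. Qed.

Lemma row_projector_L2 : X * L2 = (q * Q j)%:S * X.
Proof. by case: HE => _ _ _ _ EC2; rewrite -EC2 row_projectorL2. Qed.

Let qU : q \is a GRing.unit. Proof. by rewrite unitfE. Qed.
Let sU m : q * Q j - Q m \is a GRing.unit. Proof. by rewrite unitfE subr_eq0. Qed.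
Let tq : q * (q * Q j) = (q - 1) * (q * Q j) + q * Q j. Proof. by ring. Qed.

Lemma row_projectorT : T * X = q%:S * X.
Proof.
exact: (eigen_Tl cyc quad TL1 qU (erefl (q - 1)) row_projectorL1 row_projectorL2 tq sU).
Qed.

Lemma row_projector_T : X * T = q%:S * X.
Proof.
exact: (eigen_Tr cyc TL1 (erefl (q - 1)) row_projector_L1 row_projector_L2 tq sU).
Qed.

Variable chi : {rmorphism A -> F^o}.
Hypothesis chiS : forall b, chi b%:S = b.
Hypotheses (chi1 : chi L1 = Q j) (chi2 : chi L2 = q * Q j).
Hypothesis Q_inj : injective Q.
Hypothesis w_inj : injective (w j).

Lemma row_projector_char : chi X = 1.
Proof.
case: HE => E1 EL1 EL2 _ _.
rewrite -(rmorph1 chi) -E1 rmorph_sum (bigD1 j) //= rmorph_sum (bigD1 (Some j)) //=.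
rewrite !big1 ?addr0 // => [m mj|c cj].
  rewrite rmorph_sum big1 // => c _; apply: character_kills (EL1 m c) _ => //.
  by rewrite chi1 (inj_eq Q_inj) eq_sym.
apply: character_kills (EL2 j c) _ => //.
by rewrite chi2 -wj (inj_eq w_inj) eq_sym.
Qed.

End RowProjector.

Section Naturality.
Variables (R : comNzRingType) (X : choiceType) (A B : pzAlgType R).
Variables (h : {rmorphism A -> B}) (phi : X -> A).
Hypothesis hS : forall a, h a%:S = a%:S.

Lemma free_eval_comp (x : free_alg R X) :
  free_eval idfun (h \o phi) x = h (free_eval idfun phi x).
Proof.
rewrite !free_evalEsum rmorph_sum; apply: eq_bigr => m _.
by rewrite rmorphM hS rmorph_prod.
Qed.

End Naturality.

Section RowElement.
Variables (F : fieldType) (e l n : nat) (q : F) (khat : 'I_l -> int).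
Hypotheses (e_gt1 : (1 < e)%N) (l_gt1 : (1 < l)%N) (n_gt1 : (1 < n)%N).
Hypothesis q_prim : e.-primitive_root q.
Hypothesis khat_adj : strongly_adjacency_free e n khat.

Local Notation kap := (kappa e khat).
Local Notation HF := (heckeF e n q khat).
Local Notation gF := (h2_gen e n_gt1 q khat).
Let q0 : q != 0 := q_neq0 e_gt1 q_prim.
Let adj := kappa_adj khat_adj.

Lemma hecke2O_to_F_subalg (x : hecke2O q khat) :
  in_subalg gF (hecke2O_to_F e n_gt1 x).
Proof.
rewrite -(hom_to_FE e_gt1 n_gt1 q_prim).
elim/presented_ind: x => [|x y|a x|x g].
- rewrite rmorph1 -(rmorph1 (scal : F -> HF)); exact: in_subalgS.
- rewrite rmorphD; exact: in_subalgD.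
- rewrite rmorphM (hom_to_FS khat e_gt1 n_gt1 q_prim) => hx; apply: in_subalgM => //.
  exact: in_subalgS.
- rewrite rmorphM => hx; apply: in_subalgM => //.
  rewrite [X in in_subalg _ X](hom_to_FG khat e_gt1 n_gt1 q_prim); exact: in_subalg_gen.
Qed.

Lemma row_element_action (j : 'I_l) (x : hecke2O q khat) :
  hecke2O_to_K x = seminormal_idem F khat (one_row_tableau j) ->
  let X := hecke2O_to_F e n_gt1 x in
  trivial_char e n q khat j X = 1 /\
  forall g, gF g * X = (one_row_action e q khat j g)%:S * X /\
            X * gF g = (one_row_action e q khat j g)%:S * X.
Proof.
move=> xK X; rewrite {}/X.
have [E0 [EP ->]] := hecke_projectors e_gt1 l_gt1 n_gt1 q_prim khat_adj xK.
have cyc := rank2_cyc (h2_rel (e := e) (q := q) (khat := khat) n_gt1).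
have quad := rank2_quad (h2_rel (e := e) (q := q) (khat := khat) n_gt1).
have TL := rank2_TL (h2_rel (e := e) (q := q) (khat := khat) n_gt1).
have wE : q ^+ (kap j + 1 : 'Z_e)%R = q * q ^+ kap j by exact: q_expD1.
have wj : q ^+ second_residue kap j (Some j) = q * q ^+ kap j by rewrite /= eqxx.
have qQ m : q * q ^+ kap j != q ^+ kap m.
  rewrite -wj; apply/eqP => /(qpow_inj e_gt1 q_prim)/eqP; apply/negP.
  by apply: second_residue_kap; rewrite //= eqxx.
have PL1 := row_projectorL1 EP j.
have PL2 := row_projectorL2 EP wj.
have PL1r := row_projector_L1 EP j.
have PL2r := row_projector_L2 EP wj.
have PT := row_projectorT cyc quad TL q0 EP wj qQ.
have PTr := row_projector_T cyc TL EP wj qQ.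
split; last first.
  case=> [k|r]; last first.
    have -> : r = ord0 by case: r => -[|//] ?; apply: val_inj.
    by split; [exact: PT | exact: PTr].
  case: (I2P k) => -> /=; rewrite ?addn0 ?addn1 ?exprS.
    by split; [exact: PL1|exact: PL1r].
  by split; [exact: PL2|exact: PL2r].
apply: (row_projector_char EP wj (chi := trivial_char e n q khat j)).
- by move=> a; exact: trivial_charS.
- by apply: etrans (trivial_charG _ _ _ _ _) _; rewrite /= expr0 mulr1.
- by apply: etrans (trivial_charG _ _ _ _ _) _; rewrite /= expr1 mulrC.
- by move=> m m' /(qpow_inj e_gt1 q_prim)/(kap_inj adj).
- by move=> c d /(qpow_inj e_gt1 q_prim)/(second_residue_inj e_gt1 l_gt1 adj).
Qed.

End RowElement.

Section SubalgChar.
Variables (F : fieldType) (A : pzAlgType F) (I : Type) (phi : I -> A).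
Variables (chi : {rmorphism A -> F^o}) (X : A).
Hypothesis chiS : forall b, chi b%:S = b.
Hypothesis gX : forall g, phi g * X = (chi (phi g))%:S * X.
Hypothesis Xg : forall g, X * phi g = (chi (phi g))%:S * X.

Lemma subalg_char y : in_subalg phi y ->
  y * X = (chi y)%:S * X /\ X * y = (chi y)%:S * X.
Proof.
elim=> [g|a|x z _ [xX Xx] _ [zX Xz]|x z _ [xX Xx] _ [zX Xz]] //.
- by rewrite chiS -scalC.
- by rewrite mulrDl mulrDr xX Xx zX Xz rmorphD rmorphD -mulrDl.
- have cM : (chi (x * z))%:S = (chi x)%:S * (chi z)%:S :> A.
    by rewrite -[RHS](rmorphM (scal : F -> A)) rmorphM.
  rewrite cM; split.
    by rewrite -mulrA zX scalCA xX mulrA [X in X * _]scalC.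
  by rewrite (mulrA X) Xx -(mulrA (chi x)%:S X) Xz mulrA.
Qed.

Hypothesis sX : in_subalg phi X.
Hypothesis chiX : chi X = 1.

Definition subalg_elt : subalg phi := Sub X (introT (asboolP _) sX).

Definition chi_sub : {rmorphism subalg phi -> F} :=
  (chi : {rmorphism A -> F}) \o \val.

Lemma subalg_elt_l (y : subalg phi) : y * subalg_elt = (chi_sub y)%:S * subalg_elt.
Proof.
apply: val_inj; rewrite !rmorphM /=.
by case: (subalg_char (elimT (asboolP _) (valP y))).
Qed.

Lemma subalg_elt_r (y : subalg phi) : subalg_elt * y = (chi_sub y)%:S * subalg_elt.
Proof.
apply: val_inj; rewrite !rmorphM /=.
by case: (subalg_char (elimT (asboolP _) (valP y))).
Qed.

Lemma chi_sub_elt : chi_sub subalg_elt = 1. Proof. exact: chiX. Qed.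

Lemma chi_sub_ext (chi' : {rmorphism subalg phi -> F}) :
  (forall a, chi' a%:S = a) -> (forall g, chi' (sub_gen phi g) = chi (phi g)) ->
  chi' =1 chi_sub.
Proof.
move=> chi'S chi'G [y yP]; rewrite [RHS]/(chi y).
have ys := elimT (asboolP _) yP; elim: ys yP => [g|a|x z hx IHx hz IHz|x z hx IHx hz IHz] yP.
- by apply: etrans _ (chi'G g); congr (chi' _); exact: val_inj.
- by apply: etrans _ (esym (chiS a)); rewrite -[RHS]chi'S; congr (chi' _); exact: val_inj.
- apply: etrans _ (esym (rmorphD chi x z)).
  apply: etrans _ (congr2 (fun a b : F => a + b) (IHx (introT (asboolP _) hx))
    (IHz (introT (asboolP _) hz))).
  by rewrite -rmorphD; congr (chi' _); exact: val_inj.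
- apply: etrans _ (esym (rmorphM chi x z)).
  apply: etrans _ (congr2 (fun a b : F => a * b) (IHx (introT (asboolP _) hx))
    (IHz (introT (asboolP _) hz))).
  by rewrite -rmorphM; congr (chi' _); exact: val_inj.
Qed.

Lemma subalg_elt_primitive : primitive_central_idempotent subalg_elt.
Proof.
exact: (character_idem_primitive subalg_elt_l subalg_elt_r chi_sub_elt).
Qed.

Lemma subalg_elt_unique (chi' : {rmorphism subalg phi -> F}) x :
  (forall a, chi' a%:S = a) -> (forall g, chi' (sub_gen phi g) = chi (phi g)) ->
  chi' x = 1 -> primitive_central_idempotent x -> val x = X.
Proof.
move=> chi'S chi'G c1 px; rewrite (chi_sub_ext chi'S chi'G) in c1.
by rewrite (character_idem_unique subalg_elt_l subalg_elt_r chi_sub_elt px c1).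
Qed.

End SubalgChar.

Section RowIdempotent.
Variables (F : fieldType) (e l n : nat) (q : F) (khat : 'I_l -> int).
Hypotheses (e_gt1 : (1 < e)%N) (l_gt1 : (1 < l)%N) (n_gt1 : (1 < n)%N).
Hypothesis q_prim : e.-primitive_root q.
Hypothesis khat_adj : strongly_adjacency_free e n khat.

Local Notation kap := (kappa e khat).
Local Notation HF := (heckeF e n q khat).
Local Notation gF := (h2_gen e n_gt1 q khat).

Variables (j : 'I_l) (x : hecke2O q khat).
Hypothesis xK : hecke2O_to_K x = seminormal_idem F khat (one_row_tableau j).
Local Notation X := (hecke2O_to_F e n_gt1 x).
Local Notation chi := (trivial_char e n q khat j).

Let chiG g : chi (gF g) = one_row_action e q khat j g.
Proof.
case: g => [k|r]; apply: etrans (trivial_charG _ _ _ _ _) _ => //=.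
by rewrite exprD.
Qed.

Let chiS a : chi a%:S = a. Proof. exact: trivial_charS. Qed.

Let facts := row_element_action e_gt1 l_gt1 n_gt1 q_prim khat_adj xK.

Let gX g : gF g * X = (chi (gF g))%:S * X.
Proof. by rewrite chiG; case: facts => _ /(_ g) []. Qed.
Let Xg g : X * gF g = (chi (gF g))%:S * X.
Proof. by rewrite chiG; case: facts => _ /(_ g) []. Qed.

Let sX : in_subalg gF X.
Proof. exact: hecke2O_to_F_subalg. Qed.

(** The description of a row idempotent by the character determines it, so the
    ideal has exactly one generator for each component. *)
Lemma row_idemP (y : hecke2 e n_gt1 q khat) :
  is_row_idem j y <-> val y = X.
Proof.
split=> [[py [chi' [cS cG c1]]]|yX].
  apply: (subalg_elt_unique chiS gX Xg sX _ cS _ c1 py).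
    by case: facts.
  by move=> g; rewrite cG -chiG.
have -> : y = subalg_elt sX by exact: val_inj.
split; first by apply: (subalg_elt_primitive chiS gX Xg); case: facts.
exists (chi_sub gF chi); split.
- exact: chiS.
- by move=> g; exact: chiG.
- by case: facts.
Qed.

End RowIdempotent.

(** * Comparison of the two quotients *)

Section Quotients.
Variables (F : fieldType) (e l n : nat) (q : F) (khat : 'I_l -> int).
Hypotheses (e_gt1 : (1 < e)%N) (l_gt1 : (1 < l)%N) (n_gt1 : (1 < n)%N).
Hypothesis q_prim : e.-primitive_root q.
Hypothesis khat_adj : strongly_adjacency_free e n khat.
Variable f : {rmorphism klrR F e n khat -> heckeF e n q khat}.
Variable finv : heckeF e n q khat -> klrR F e n khat.
Hypotheses (fK : cancel f finv) (finvK : cancel finv f).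
Hypothesis f_bkr : bkr_morphism f.

Local Notation kap := (kappa e khat).
Local Notation HF := (heckeF e n q khat).
Local Notation blob := (blob_alg F n kap).
Local Notation mw := (mw_blob e n_gt1 q khat).

Definition row_gen (z : HF) : Prop :=
  exists (j : 'I_l) (x : hecke2 e n_gt1 q khat), is_row_idem j x /\ z = val x.

Definition row_sum (j : 'I_l) : klrR F e n khat :=
  \sum_(i : residues e n | (i (widen_ord n_gt1 ord0) == kap j) &&
                (i (widen_ord n_gt1 ord_max) == kap j + 1)) klrR_gen F khat (E i).

Lemma row_genP z : row_gen z <-> exists j, z = f (row_sum j).
Proof.
split=> [[j [y [/row_idemP yj ->]]]|[j ->]]; exists j;
  have [x xK] := row_element e_gt1 l_gt1 n_gt1 q_prim khat_adj j.
  rewrite (yj x e_gt1 l_gt1 q_prim khat_adj xK).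
  by rewrite (row_element_sum e_gt1 l_gt1 n_gt1 q_prim khat_adj f_bkr xK).
have sX := hecke2O_to_F_subalg e_gt1 n_gt1 q_prim x.
pose y : hecke2 e n_gt1 q khat := subalg_elt sX.
exists y; split.
  exact: (proj2 (row_idemP e_gt1 l_gt1 q_prim khat_adj xK y) erefl).
by rewrite -(row_element_sum e_gt1 l_gt1 n_gt1 q_prim khat_adj f_bkr xK).
Qed.

Definition to_blob : {rmorphism klrR F e n khat -> blob} :=
  lift_morphism (@klr_to_blob_rel F e l n kap).

Lemma to_blobG g : to_blob (klrR_gen F khat g) = blob_gen F kap g.
Proof. by apply: plift_gen; exact: klr_to_blob_rel. Qed.

Lemma to_blob_surj u : exists x, to_blob x = u.
Proof.
elim/presented_ind: u => [|u v [x <-] [y <-]|a u [x <-]|u g [x <-]].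
- by exists 1; rewrite rmorph1.
- by exists (x + y); rewrite rmorphD.
- exists (a%:S * x); rewrite rmorphM; congr (_ * _).
  by apply: plift_scal; exact: klr_to_blob_rel.
- by exists (x * klrR_gen F khat g); rewrite rmorphM to_blobG.
Qed.

Lemma klrEE (i j : residues e n) : klrR_gen F khat (E i) * klrR_gen F khat (E j) =
  if i == j then klrR_gen F khat (E i) else 0.
Proof.
have := pgen_rel (klr_EE F kap i j); rewrite free_evalM !free_eval_gen => ->.
by case: ifP; rewrite ?free_eval_gen ?free_eval0.
Qed.

Lemma to_blob_row j : to_blob (row_sum j) = 0.
Proof.
rewrite rmorph_sum big1 // => i /andP[/eqP i0 /eqP i1]; rewrite to_blobG.
have := @pgen_rel F _ (@blob_rel F e l n kap) _ _
  (@blob_E0 F e l n kap i (widen_ord n_gt1 ord0) (widen_ord n_gt1 ord_max)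
   erefl erefl _ _).
rewrite i0 i1 codom_f => /(_ isT erefl).
by rewrite free_eval_gen free_eval0.
Qed.

Lemma in_ideal_blob z : in_ideal row_gen z -> to_blob (finv z) = 0.
Proof.
elim=> {z} [z /row_genP[j ->]||x y _ hx _ hy|a x b _ hx].
- by rewrite fK to_blob_row.
- by rewrite -(rmorph0 f) fK rmorph0.
- rewrite (_ : finv (x - y) = finv x - finv y); last first.
    by rewrite -[RHS]fK rmorphB !finvK.
  by rewrite rmorphB hx hy subrr.
- rewrite (_ : finv (a * x * b) = finv a * finv x * finv b); last first.
    by rewrite -[RHS]fK !rmorphM !finvK.
  by rewrite !rmorphM hx mulr0 mul0r.
Qed.

(** e(i) is a multiple of the row sum containing it, by orthogonality. *)
Lemma blob_E0_ideal (j : 'I_l) (i : residues e n) :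
  i (widen_ord n_gt1 ord0) = kap j -> i (widen_ord n_gt1 ord_max) = kap j + 1 ->
  in_ideal row_gen (f (klrR_gen F khat (E i))).
Proof.
move=> i0 i1.
have -> : klrR_gen F khat (E i) = 1 * row_sum j * klrR_gen F khat (E i).
  rewrite mul1r mulr_suml (bigD1 i) ?i0 ?i1 ?eqxx //= klrEE eqxx big1 ?addr0 //.
  by move=> k /andP[_ /negPf ki]; rewrite klrEE ki.
rewrite !rmorphM; apply: in_idealM; apply: in_ideal_gen.
by apply/row_genP; exists j.
Qed.

Definition mw_hom : {rmorphism klrR F e n khat -> mw} :=
  (qpi row_gen : {rmorphism HF -> mw}) \o f.

Lemma mw_homE x : mw_hom x = mw_pi n_gt1 (f x). Proof. by []. Qed.

Lemma mw_homS a : mw_hom a%:S = a%:S.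
Proof. by rewrite /=; case: f_bkr => -> _ _. Qed.

Lemma mw_hom_eq0 x : in_ideal row_gen (f x) -> mw_hom x = 0.
Proof.
move=> fx; rewrite -(rmorph0 (qpi row_gen)).
by apply/(qpi_eq row_gen); rewrite subr0.
Qed.

Lemma mw_rel u v : blob_rel kap u v ->
  free_eval idfun (mw_hom \o klrR_gen F khat) u =
  free_eval idfun (mw_hom \o klrR_gen F khat) v.
Proof.
rewrite !(free_eval_comp _ mw_homS) => -[{}u {}v uv|i k m k0 m1 ik im].
  by congr (mw_hom _); exact: pgen_rel.
rewrite free_eval_gen free_eval0 rmorph0; apply: mw_hom_eq0.
have k0' : k = widen_ord n_gt1 ord0 by exact: val_inj.
have m1' : m = widen_ord n_gt1 ord_max by exact: val_inj.
have [j ij] := codomP ik.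
apply: (@blob_E0_ideal j); first by rewrite -k0'.
by rewrite -m1' im ij.
Qed.

Definition blob_iso : {rmorphism blob -> mw} := lift_morphism mw_rel.

Lemma blob_isoE x : blob_iso (to_blob x) = mw_hom x.
Proof.
elim/presented_ind: x => [|x y IHx IHy|a x IH|x g IH].
- by rewrite !rmorph1.
- by rewrite !rmorphD IHx IHy.
- rewrite !rmorphM IH; congr (_ * _); rewrite mw_homS.
  have -> : to_blob a%:S = a%:S by apply: plift_scal; exact: klr_to_blob_rel.
  by apply: plift_scal; exact: mw_rel.
- rewrite !rmorphM IH; congr (_ * _).
  have -> : to_blob (pgen _ g) = pgen _ g by exact: to_blobG.
  by apply: plift_gen; exact: mw_rel.
Qed.

Lemma blob_iso_scalar : scalar_morphism blob_iso.
Proof. by move=> a; apply: plift_scal; exact: mw_rel. Qed.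

(** The inverse lifts to H_n, applies the inverse of f and projects; it is well
    defined because the row sums vanish in the blob algebra. *)
Lemma blob_iso_bij : bijective blob_iso.
Proof.
exists (fun v : mw => to_blob (finv (repr v))) => [u|v].
  have [x <-] := to_blob_surj u; rewrite blob_isoE mw_homE.
  set r := repr _; have /in_ideal_blob : in_ideal row_gen (f x - r).
    by apply/qpi_eq; rewrite qpi_repr.
  have -> : finv (f x - r) = x - finv r by rewrite -[RHS]fK rmorphB finvK.
  by rewrite rmorphB => /eqP; rewrite subr_eq0 => /eqP.
by rewrite blob_isoE /= finvK; exact: qpi_repr.
Qed.

End Quotients.

Theorem theorem42 (F : fieldType) (e l n : nat) (q : F) (khat : 'I_l -> int)
    (e_gt1 : (1 < e)%N) (l_gt1 : (1 < l)%N) (n_gt1 : (1 < n)%N)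
    (q_neq1 : q != 1) (q_prim : e.-primitive_root q)
    (khat_adj : strongly_adjacency_free e n khat)
    (f : {rmorphism klrR F e n khat -> heckeF e n q khat})
    (finv : heckeF e n q khat -> klrR F e n khat)
    (fK : cancel f finv) (finvK : cancel finv f)
    (f_bkr : bkr_morphism f) :
  (forall j : 'I_l,
     (exists x : hecke2O q khat,
        hecke2O_to_K x = seminormal_idem F khat (one_row_tableau j)) /\
     (forall x : hecke2O q khat,
        hecke2O_to_K x = seminormal_idem F khat (one_row_tableau j) ->
        finv (hecke2O_to_F e n_gt1 x) =
          \sum_(i : residues e n |
                (i (widen_ord n_gt1 ord0) == kappa e khat j) &&
                (i (widen_ord n_gt1 ord_max) == kappa e khat j + 1))
             klrR_gen F khat (E i))) /\
  (exists g : {rmorphism blob_alg F n (kappa e khat) ->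
                         mw_blob e n_gt1 q khat},
     [/\ scalar_morphism g, bijective g &
         forall x : klrR F e n khat, g (klr_to_blob x) = mw_pi n_gt1 (f x)]).
Proof.
split.
  move=> j; split; first exact: row_element e_gt1 l_gt1 n_gt1 q_prim khat_adj j.
  move=> x xK.
  by rewrite (row_element_sum e_gt1 l_gt1 n_gt1 q_prim khat_adj f_bkr xK) fK.
exists (blob_iso e_gt1 l_gt1 n_gt1 q_prim khat_adj f_bkr); split.
- exact: blob_iso_scalar.
- exact: (blob_iso_bij e_gt1 l_gt1 n_gt1 q_prim khat_adj fK finvK f_bkr).
- exact: blob_isoE.
Qed.
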